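(* For any $\alpha\ge1$, the map $$\mathbb S:\big(\mathbb A_t^{[\alpha]}\langle\langle z\rangle\rangle,\ \circ\big)\to\big(\mathbf{Hopf}(\mathcal N\mathrm{Sym},\mathcal D^{[\alpha]}\langle\langle z\rangle\rangle),\ \circledast\big),\qquad F_t\mapsto\mathcal S_{F_t},$$ is an isomorphism of groups.
   Context: Setup. $K$ is a unital commutative $\mathbb Q$-algebra, $z=(z_1,\dots,z_n)$ ($n\ge 1$) are independent variables, either commutative or noncommutative (free); statements hold in both cases and the same notation is used for both. $t$ is a formal parameter commuting with everything. $K\langle\langle z\rangle\rangle$ and $K[[t]]\langle\langle z\rangle\rangle$ are the formal power series algebras in $z$ over $K$ and $K[[t]]$. $o(u)$ is the lowest degree in $z$ of the monomials occurring in $u$ (for a vector, the minimum over its components). $\mathcal Der^{[\alpha]}\langle\langle z\rangle\rangle$ is the set of $K$-derivations of $K\langle\langle z\rangle\rangle$ that increase the degree in $z$ by at least $\alpha-1$ (i.e. those sending each $z_i$ to some $u_i$ with $o(u_i)\ge\alpha$), and $\mathcal D^{[\alpha]}\langle\langle z\rangle\rangle$ is the unital subalgebra of $\mathrm{End}_K(K\langle\langle z\rangle\rangle)$ generated by $\mathcal Der^{[\alpha]}\langle\langle z\rangle\rangle$. Hopf structure on differential operators (the paper's convention): the algebra generated by derivations is identified with the universal enveloping algebra of the Lie algebra of derivations, and carries the corresponding $K$-Hopf algebra structure, determined on derivations $\delta$ by $\Delta(\delta)=1\otimes\delta+\delta\otimes1$, $S(\delta)=-\delta$, $\epsilon(\delta)=\delta\cdot1$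 $(=0)$; $\mathcal D^{[\alpha]}\langle\langle z\rangle\rangle$ carries this structure. $\mathbb A_t^{[\alpha]}\langle\langle z\rangle\rangle$ is the group of automorphisms $F_t(z)=z-H_t(z)$ of $K[[t]]\langle\langle z\rangle\rangle$ over $K[[t]]$ with $H_t(z)\in K[[t]]\langle\langle z\rangle\rangle^{\times n}$, $o(H_t(z))\ge\alpha$ and $H_{t=0}(z)=0$; the product $\circ$ is composition of formal maps, $(U_t\circ V_t)(z)=U_t(V_t(z))$. $\mathcal N\mathrm{Sym}=K\langle\Lambda\rangle$ is the free associative $K$-algebra on $\Lambda_m$ ($m\ge1$), $\Lambda_0=1$, $\lambda(t)=\sum_{m\ge0}t^m\Lambda_m$, $\sigma(t)=\sum_{m\ge0}t^mS_m:=\lambda(-t)^{-1}$; $\Psi_m$ is defined by $\frac{d\sigma(t)}{dt}=\sigma(t)\sum_{m\ge1}t^{m-1}\Psi_m$, and $\mathcal N\mathrm{Sym}$ is the $K$-Hopf algebra with $\Delta(\Psi_m)=1\otimes\Psi_m+\Psi_m\otimes1$, $\epsilon(\Psi_m)=0$, $S(\Psi_m)=-\Psi_m$. $\mathcal N\mathrm{Sym}$ is freely generated by the $S_m$ ($m\ge1$). For $F_t\in\mathbb A_t^{[\alpha]}\langle\langle z\rangle\rangle$, let $\lambda_m\in\mathcal D^{[\alpha]}\langle\langle z\rangle\rangle$ ($m\ge0$, $\lambda_0=1$) be the unique sequence such that $\big(\sum_{m\ge0}(-1)^mt^m\lambda_m\big)u_t(z)=u_t(F_t(z))$ for all $u_t\in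 K[[t]]\langle\langle z\rangle\rangle$. $\mathcal S_{F_t}:\mathcal N\mathrm{Sym}\to\mathcal D^{[\alpha]}\langle\langle z\rangle\rangle$ is the unique $K$-algebra homomorphism with $\mathcal S_{F_t}(\Lambda_m)=\lambda_m$ for all $m\ge1$ (it is a $K$-Hopf algebra homomorphism). $\mathbf{Hopf}(\mathcal N\mathrm{Sym},\mathcal D^{[\alpha]}\langle\langle z\rangle\rangle)$ is the set of $K$-Hopf algebra homomorphisms $\mathcal N\mathrm{Sym}\to\mathcal D^{[\alpha]}\langle\langle z\rangle\rangle$. Its group product $\circledast$ is defined as follows. Let $\mathbf{DPS}(\mathcal D^{[\alpha]}\langle\langle z\rangle\rangle)$ be the set of sequences of divided powers $\{a_m\mid m\ge0\}$, $a_0=1$, in $\mathcal D^{[\alpha]}\langle\langle z\rangle\rangle$ (i.e. $\Delta a_m=\sum_{i+j=m}a_i\otimes a_j$), identified with the set of generating functions $a(t)=\sum_{m\ge0}a_mt^m$ with $a_0=1$ and $\Delta a(t)=a(t)\otimes a(t)$; it is a group under multiplication in $\mathcal D^{[\alpha]}\langle\langle z\rangle\rangle[[t]]$. The map $\mathcal T\mapsto\{\mathcal T(S_m)\mid m\ge0\}$ is a bijection from $\mathbf{Hopf}(\mathcal N\mathrm{Sym},\mathcal D^{[\alpha]}\langle\langle z\rangle\rangle)$ onto $\mathbf{DPS}(\mathcal D^{[\alpha]}\langle\langle z\rangle\rangle)$, and $\circledast$ is the group product transported through this bijection; that is, $(\mathcal T_1\circledast\mathcal T_2)(\sigma(t))=\mathcal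 T_1(\sigma(t))\,\mathcal T_2(\sigma(t))$.
   Formalization: For commuting z, Δ(δ)=1⊗δ+δ⊗1 defines no map on D^[α] in End_K: for a=z_2^{α+1}∂_1, b=z_2^α∂_1, c=z_2^{α+2}∂_1, a²=cb but Δ(a)²≠Δ(c)Δ(b). So Δ, ε, S on D^[α] are taken as relations, holding when some expression in derivations gives the value. *)

(* Defs.v *)
From HB Require Import structures.
From mathcomp Require Import all_boot all_algebra finmap.
From mathcomp Require Import boolp classical_sets functions.
From mathcomp.multinomials Require Import monalg.

Set Implicit Arguments.
Unset Strict Implicit.
Unset Printing Implicit Defensive.

Import GRing.Theory.
Local Open Scope ring_scope.

(* Commutative and noncommutative variables are treated uniformly: zmonType n is
   a monoid of monomials in n variables, graded by the length of words. zword m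
   is one word that multiplies out to m; for commuting variables it is the
   sorted one, for free variables it is m itself. *)
HB.mixin Record MonomialDef_isZMonom (n : nat) M of MonomialDef M := {
  zgen : 'I_n -> M;
  zword : M -> seq 'I_n;
  zwordK : forall m : M, \big[@mmul _/@mone _]_(i <- zword m) zgen i = m;
  size_zwordM : forall a b : M,
    size (zword (mmul a b)) = (size (zword a) + size (zword b))%N;
  zword_gen : forall i, zword (zgen i) = [:: i]
}.

#[short(type="zmonType")]
HB.structure Definition ZMonom (n : nat) :=
  { M of MonomialDef M & MonomialDef_isZMonom n M }.

Section Free.
Variable n : nat.

Fact fword_K (m : {fmonom 'I_n}) : \big[@mmul _/@mone _]_(i <- (m : seq _)) fmu i = m.
Proof.
apply/eqP; rewrite fmP; apply/eqP.
elim: (m : seq _) => [|i s IHs]; first by rewrite big_nil fm1.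
by rewrite big_cons fmM fmU IHs.
Qed.
Fact fword_size (a b : {fmonom 'I_n}) :
  size (mmul a b : seq _) = (size (a : seq _) + size (b : seq _))%N.
Proof. by rewrite fmM size_cat. Qed.
Fact fword_gen (i : 'I_n) : (fmu i : seq _) = [:: i]. Proof. exact: fmU. Qed.
HB.instance Definition _ := MonomialDef_isZMonom.Build n {fmonom 'I_n}
  fword_K fword_size fword_gen.
End Free.

Section Comm.
Variable n : nat.

Definition cword (m : {cmonom 'I_n}) : seq 'I_n := flatten [seq nseq (m i) i | i <- enum 'I_n].
Fact cword_K (m : {cmonom 'I_n}) : \big[@mmul _/@mone _]_(i <- cword m) ucm i = m.
Proof.
apply/eqP/cmP => j.
have cmB (s : seq 'I_n) :
    (\big[@mmul _/@mone _]_(i <- s) ucm i) j = count_mem j s.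
  elim: s => [|i s IHs]; first by rewrite big_nil cm1.
  by rewrite big_cons cmM IHs cmU.
rewrite cmB /cword count_flatten -map_comp sumnE big_map big_enum /=.
rewrite (bigD1 j) //= count_nseq /= eqxx mul1n big1 ?addn0 // => i /negPf ne.
by rewrite count_nseq /= ne.
Qed.
Fact cword_size (a b : {cmonom 'I_n}) : size (cword (mmul a b)) = (size (cword a) + size (cword b))%N.
Proof.
rewrite /cword !size_flatten /shape -!map_comp !sumnE !big_map -big_split /=.
by apply: eq_bigr => i _; rewrite !size_nseq cmM.
Qed.
Fact cword_gen (i : 'I_n) : cword (ucm i) = [:: i].
Proof.
rewrite /cword; have -> : [seq nseq (ucm i j) j | j <- enum 'I_n]
   = [seq (if j == i then [:: j] else [::]) | j <- enum 'I_n].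
  apply: eq_map => j; rewrite cmU eq_sym; by case: (j == i).
have <- : filter (pred1 i) (enum 'I_n) = [:: i].
  by rewrite filter_pred1_uniq ?enum_uniq ?mem_enum.
by elim: (enum _) => //= j s ->; case: (j == i).
Qed.
HB.instance Definition _ := MonomialDef_isZMonom.Build n {cmonom 'I_n}
  cword_K cword_size cword_gen.
End Comm.

(* The powers of t, written additively: fps tmon R below is R[[t]]. *)
Definition tmon : Type := nat.
HB.instance Definition _ := Choice.on tmon.
Fact tmon_unit (x y : tmon) : (x + y = 0)%N -> x = 0%N /\ y = 0%N.
Proof. by move/eqP; rewrite addn_eq0 => /andP[/eqP-> /eqP->]. Qed.
HB.instance Definition _ :=
  Choice_isMonomialDef.Build tmon addnA add0n addn0 tmon_unit.
Fact tword_K (k : tmon) :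
  \big[@mmul tmon/@mone tmon]_(i <- nseq k (@ord0 0)) (1%N : tmon) = k.
Proof. by elim: k => [|k IHk]; rewrite ?big_nil //= big_cons IHk. Qed.
Fact tword_size (a b : tmon) :
  size (nseq (mmul a b) (@ord0 0)) = (size (nseq a (@ord0 0)) + size (nseq b (@ord0 0)))%N.
Proof. by rewrite !size_nseq. Qed.
Fact tword_gen (i : 'I_1) : nseq 1 (@ord0 0) = [:: i].
Proof. by rewrite (ord1 i). Qed.
HB.instance Definition _ := MonomialDef_isZMonom.Build 1 tmon
   tword_K tword_size tword_gen.

Section Degree.
Variables (n : nat) (M : zmonType n).
Implicit Types (m a b : M) (s : seq 'I_n).

Definition zdeg m : nat := size (zword m).

Definition zmon_of s : M := \big[@mmul _/@mone _]_(i <- s) zgen i.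

Fixpoint words (d : nat) : seq (seq 'I_n) :=
  if d is d'.+1 then
    [::] :: [seq i :: w | i <- enum 'I_n, w <- words d']
  else [:: [::]].

Definition zmons (d : nat) : seq M := undup [seq zmon_of w | w <- words d].

Lemma zdegM a b : zdeg (mmul a b) = (zdeg a + zdeg b)%N.
Proof. exact: size_zwordM. Qed.

Lemma zdeg1 : zdeg (@mone M) = 0%N.
Proof. by apply/eqP; rewrite -(eqn_add2l (zdeg mone)) -zdegM mul1m addn0. Qed.

Lemma zdeg_mon_of s : zdeg (zmon_of s) = size s.
Proof.
elim: s => [|i s IHs]; rewrite /zmon_of ?big_nil ?zdeg1 // big_cons zdegM.
by rewrite -/(zmon_of s) IHs /zdeg zword_gen.
Qed.

Lemma mem_words d s : (s \in words d) = (size s <= d)%N.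
Proof.
elim: d s => [|d IHd] [|i s] //=.
rewrite inE /= ltnS -IHd; apply/allpairsP/idP => [[[j w] /= [_ win [_ ->]]] //|sin].
by exists (i, s); rewrite mem_enum.
Qed.

Lemma mem_zmons d m : (m \in zmons d) = (zdeg m <= d)%N.
Proof.
rewrite mem_undup; apply/mapP/idP => [[w]|le].
  by rewrite mem_words => ? ->; rewrite zdeg_mon_of.
by exists (zword m); rewrite ?mem_words // /zmon_of zwordK.
Qed.

Lemma zmons_uniq d : uniq (zmons d). Proof. exact: undup_uniq. Qed.

Lemma zmons_sub (V : nmodType) (P : pred M) (F : M -> V) d e :
  (d <= e)%N -> (forall a, P a -> (zdeg a <= d)%N) ->
  \sum_(a <- zmons d | P a) F a = \sum_(a <- zmons e | P a) F a.
Proof.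
move=> de Pd; rewrite -!(big_filter _ P); apply: perm_big; apply: uniq_perm;
  rewrite ?filter_uniq ?zmons_uniq // => a.
rewrite !mem_filter !mem_zmons; case Pa: (P a) => //=.
by rewrite (Pd _ Pa) (leq_trans (Pd _ Pa) de).
Qed.

End Degree.

Lemma big_only (T : eqType) (V : nmodType) (s : seq T) x (P : pred T) (F : T -> V) :
  uniq s -> x \in s -> P =1 pred1 x -> \sum_(e <- s | P e) F e = F x.
Proof.
move=> us xs Px; rewrite (eq_bigl _ _ Px) -big_filter.
by rewrite (filter_pred1_uniq us xs) big_seq1.
Qed.

(* R<<z>>, or R[[z]] when M is commutative: all coefficient functions. *)
Definition fps (n : nat) (M : zmonType n) (R : Type) : Type := M -> R.

Section FpsRing.
Variables (n : nat) (M : zmonType n).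

HB.instance Definition _ (R : choiceType) := Choice.copy (fps M R) (M -> R).
HB.instance Definition _ (R : zmodType) := GRing.Zmodule.copy (fps M R) (M -> R).

Variable R : nzRingType.
Implicit Types (u v w : fps M R).

Definition fps_mul u v : fps M R := fun m =>
  \sum_(a <- zmons M (zdeg m)) \sum_(b <- zmons M (zdeg m) | mmul a b == m)
     u a * v b.

Definition fps_const (c : R) : fps M R := fun m => if m == mone then c else 0.

Lemma fps_mulw d u v m : (zdeg m <= d)%N ->
  fps_mul u v m =
  \sum_(a <- zmons M d) \sum_(b <- zmons M d | mmul a b == m) u a * v b.
Proof.
move=> le; pose Q (a : M) := has (fun b => mmul a b == m) (zmons M d).
have Qd (a : M) : Q a -> (zdeg a <= zdeg m)%N.
  by case/hasP=> b _ /eqP <-; rewrite zdegM leq_addr.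
have bd (a b : M) : mmul a b == m -> (zdeg b <= zdeg m)%N.
  by move/eqP <-; rewrite zdegM leq_addl.
transitivity (\sum_(a <- zmons M (zdeg m) | Q a) \sum_(b <- zmons M d | mmul a b == m) u a * v b).
  rewrite /fps_mul [RHS]big_mkcond; apply: eq_bigr => a _.
  rewrite (zmons_sub _ le); last exact: bd.
  case: ifPn => // /hasPn nQ; rewrite big_seq_cond big1 // => b /andP[bin ab].
  by rewrite (negPf (nQ b bin)) in ab.
rewrite (zmons_sub _ le) // big_mkcond; apply: eq_bigr => a _.
case: ifPn => // /hasPn nQ; rewrite big_seq_cond big1 // => b /andP[bin ab].
by rewrite (negPf (nQ b bin)) in ab.
Qed.

Lemma fps_mulE u v m : fps_mul u v m =
  \sum_(a <- zmons M (zdeg m)) \sum_(b <- zmons M (zdeg m) | mmul a b == m)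
     u a * v b.
Proof. by []. Qed.

Fact fps_mulA : associative fps_mul.
Proof.
move=> u v w; apply/funext => m; set Z := zmons M (zdeg m).
transitivity (\sum_(a <- Z) \sum_(b <- Z) \sum_(c <- Z | mmul a (mmul b c) == m)
   u a * v b * w c).
  rewrite (fps_mulE u); apply: eq_bigr => a _.
  transitivity (\sum_(e <- Z | mmul a e == m) \sum_(b <- Z) \sum_(c <- Z | mmul b c == e) u a * v b * w c).
    rewrite big_seq_cond [RHS]big_seq_cond; apply: eq_bigr => e /andP[ein _].
    rewrite (@fps_mulw (zdeg m)) -?mem_zmons // mulr_sumr; apply: eq_bigr => b _.
    by rewrite mulr_sumr; apply: eq_bigr => c _; rewrite mulrA.
  rewrite exchange_big /=; apply: eq_bigr => b _.
  under eq_bigr => e _ do rewrite big_mkcond /=.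
  rewrite exchange_big /= [RHS]big_mkcond /=; apply: eq_bigr => c _.
  rewrite -big_mkcondr /=; case: ifPn => abc.
    have bcin : mmul b c \in Z.
      by rewrite mem_zmons -(eqP abc) [X in (_ <= X)%N]zdegM leq_addl.
    rewrite (big_only _ (zmons_uniq M (zdeg m)) bcin) // => e /=.
    case: (eqVneq e (mmul b c)) => [->|ne]; first by rewrite abc.
    by rewrite andbF.
  rewrite big1 // => e /andP[ae /eqP bce]; by rewrite bce ae in abc.
symmetry; rewrite (fps_mulE _ w).
transitivity (\sum_(e <- Z) \sum_(c <- Z | mmul e c == m) \sum_(a <- Z) \sum_(b <- Z | mmul a b == e) u a * v b * w c).
  rewrite big_seq [RHS]big_seq; apply: eq_bigr => e ein.
  apply: eq_bigr => c _.
  rewrite (@fps_mulw (zdeg m)) -?mem_zmons // mulr_suml; apply: eq_bigr => a _.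
  by rewrite mulr_suml.
under eq_bigr => e _.
  under eq_bigr => c _ do under eq_bigr => a _ do rewrite big_mkcond /=.
  rewrite exchange_big /=; under eq_bigr => a _ do rewrite exchange_big /=.
  over.
rewrite exchange_big /=; apply: eq_bigr => a _.
rewrite exchange_big /=; apply: eq_bigr => b _.
under eq_bigr => e _ do rewrite big_mkcond /=.
rewrite exchange_big /= [RHS]big_mkcond /=; apply: eq_bigr => c _.
under eq_bigr => e _ do (rewrite -if_and).
rewrite -big_mkcond /=; case: ifPn => abc.
  have abin : mmul a b \in Z.
    by rewrite mem_zmons -(eqP abc) mulmA [X in (_ <= X)%N]zdegM leq_addr.
  rewrite (big_only _ (zmons_uniq M (zdeg m)) abin) // => e /=.
  case: (eqVneq e (mmul a b)) => [->|ne]; first by rewrite -mulmA abc.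
  by rewrite andbF.
rewrite big1 // => e /andP[ec /eqP abe]; by rewrite mulmA abe ec in abc.
Qed.

Fact fps_mul1 : left_id (fps_const 1) fps_mul.
Proof.
move=> u; apply/funext => m; rewrite /fps_mul.
rewrite (bigD1_seq mone) ?zmons_uniq //= ?mem_zmons ?zdeg1 //.
rewrite [X in _ + X]big1 ?addr0 => [|a /negPf ne]; last first.
  by rewrite big1 // => b _; rewrite /fps_const ne mul0r.
rewrite (@big_only _ _ _ m) ?zmons_uniq ?mem_zmons // => [|b].
  by rewrite /fps_const eqxx mul1r.
by rewrite /= mul1m.
Qed.

Fact fps_mulr1 : right_id (fps_const 1) fps_mul.
Proof.
move=> u; apply/funext => m; rewrite /fps_mul.
rewrite (bigD1_seq m) ?zmons_uniq //= ?mem_zmons //.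
rewrite [X in _ + X]big1 ?addr0 => [|a /negPf ne]; last first.
  rewrite big1 // => b; rewrite /fps_const; case: (eqVneq b mone) => [->|_ _].
    by rewrite mulm1 ne.
  by rewrite mulr0.
rewrite big_mkcond (bigD1_seq mone) ?zmons_uniq ?mem_zmons ?zdeg1 //= mulm1 eqxx.
rewrite /fps_const eqxx mulr1 big1 ?addr0 // => b /negPf ->.
by rewrite mulr0; case: ifP.
Qed.

Fact fps_mulDl : left_distributive fps_mul +%R.
Proof.
move=> u v w; apply/funext => m.
rewrite -[RHS]/(fps_mul u w m + fps_mul v w m) !fps_mulE.
rewrite -big_split; apply: eq_bigr => a _ /=.
by rewrite -big_split; apply: eq_bigr => b _; rewrite /= -mulrDl.
Qed.

Fact fps_mulDr : right_distributive fps_mul +%R.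
Proof.
move=> u v w; apply/funext => m.
rewrite -[RHS]/(fps_mul u v m + fps_mul u w m) !fps_mulE.
rewrite -big_split; apply: eq_bigr => a _ /=.
by rewrite -big_split; apply: eq_bigr => b _; rewrite /= -mulrDr.
Qed.

Fact fps1_neq0 : fps_const 1 != 0.
Proof.
apply/eqP => /(congr1 (fun f : fps M R => f mone)).
by rewrite /fps_const eqxx => /eqP; rewrite (negPf (oner_neq0 R)).
Qed.

HB.instance Definition _ := GRing.Zmodule_isNzRing.Build (fps M R)
  fps_mulA fps_mul1 fps_mulr1 fps_mulDl fps_mulDr fps1_neq0.

End FpsRing.

Section FpsAlg.
Variables (n : nat) (M : zmonType n) (K : comNzRingType).

HB.instance Definition _ := GRing.Lmodule.copy (fps M K) (M -> K^o).

Fact fps_scaleAl (k : K) (u v : fps M K) : k *: (u * v) = (k *: u) * v.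
Proof.
apply/funext => m.
rewrite -[LHS]/(k * fps_mul u v m) -[RHS]/(fps_mul _ _ m) !fps_mulE mulr_sumr.
by apply: eq_bigr => a _; rewrite mulr_sumr; apply: eq_bigr => b _; rewrite mulrA.
Qed.
HB.instance Definition _ := GRing.Lmodule_isLalgebra.Build K (fps M K) fps_scaleAl.

Fact fps_scaleAr (k : K) (u v : fps M K) : k *: (u * v) = u * (k *: v).
Proof.
apply/funext => m.
rewrite -[LHS]/(k * fps_mul u v m) -[RHS]/(fps_mul _ _ m) !fps_mulE mulr_sumr.
by apply: eq_bigr => a _; rewrite mulr_sumr; apply: eq_bigr => b _; rewrite mulrCA.
Qed.
HB.instance Definition _ := GRing.Lalgebra_isAlgebra.Build K (fps M K) fps_scaleAr.
End FpsAlg.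

Lemma linear_ext (K : pzRingType) (U V : lmodType K) (f g : {linear U -> V}) :
  f =1 g -> f = g.
Proof.
move=> fg; have : (f : U -> V) = g by exact/funext.
case: f g {fg} => [f [[cf1] [cf2]]] [g [[cg1] [cg2]]] /= E; case: g / E cg1 cg2 => cg1 cg2.
by rewrite (Prop_irrelevance cf1 cg1) (Prop_irrelevance cf2 cg2).
Qed.

Lemma lrmorph_ext (K : pzRingType) (A B : lalgType K) (f g : {lrmorphism A -> B}) :
  f =1 g -> f = g.
Proof.
move=> fg; have : (f : A -> B) = g by exact/funext.
case: f g {fg} => [f cf] [g cg] /= E; case: g / E cg => cg.
congr (GRing.LRMorphism.Pack _).
case: cf cg => [[cf1] [cf2] [cf3]] [[cg1] [cg2] [cg3]].
by rewrite (Prop_irrelevance cf1 cg1) (Prop_irrelevance cf2 cg2) (Prop_irrelevance cf3 cg3).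
Qed.

Section Endo.
Variables (K : comNzRingType) (A : algType K).

(* {linear A -> A} made into the algebra End_K(A), with composition as product. *)
Definition endo : Type := {linear A -> A}.
HB.instance Definition _ := gen_eqMixin endo.
HB.instance Definition _ := gen_choiceMixin endo.

Let mk (f : A -> A) (h : linear f) : endo :=
  HB.pack f (GRing.isLinear.Build K A A _ f h).
Let h0 : linear (fun _ : A => 0 : A).
Proof. by move=> k x y; rewrite scaler0 addr0. Qed.
Let hD (f g : endo) : linear (fun x => f x + g x).
Proof. by move=> k x y; rewrite !linearP scalerDr addrACA. Qed.
Let hN (f : endo) : linear (fun x => - f x).
Proof. by move=> k x y; rewrite linearP opprD scalerN. Qed.
Let h1 : linear (fun x : A => x). Proof. by []. Qed.
Let hM (f g : endo) : linear (fun x => f (g x)).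
Proof. by move=> k x y; rewrite !linearP. Qed.
Let hZ (c : K) (f : endo) : linear (fun x => c *: f x).
Proof. by move=> k x y; rewrite linearP scalerDr !scalerA mulrC. Qed.

Definition endo_zero : endo := mk h0.
Definition endo_add f g : endo := mk (hD f g).
Definition endo_opp f : endo := mk (hN f).
Definition endo_one : endo := mk h1.
Definition endo_mul f g : endo := mk (hM f g).
Definition endo_scale c f : endo := mk (hZ c f).

Lemma endoP (f g : endo) : f =1 g -> f = g. Proof. exact: linear_ext. Qed.

Fact endo_addA : associative endo_add.
Proof. by move=> f g h; apply/endoP => x; exact: addrA. Qed.
Fact endo_addC : commutative endo_add.
Proof. by move=> f g; apply/endoP => x; exact: addrC. Qed.
Fact endo_add0 : left_id endo_zero endo_add.
Proof. by move=> f; apply/endoP => x; exact: add0r. Qed.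
Fact endo_addN : left_inverse endo_zero endo_opp endo_add.
Proof. by move=> f; apply/endoP => x; exact: addNr. Qed.
HB.instance Definition _ := GRing.isZmodule.Build endo
  endo_addA endo_addC endo_add0 endo_addN.

Fact endo_mulA : associative endo_mul. Proof. by move=> f g h; apply/endoP. Qed.
Fact endo_mul1 : left_id endo_one endo_mul. Proof. by move=> f; apply/endoP. Qed.
Fact endo_mulr1 : right_id endo_one endo_mul. Proof. by move=> f; apply/endoP. Qed.
Fact endo_mulDl : left_distributive endo_mul +%R.
Proof. by move=> f g h; apply/endoP. Qed.
Fact endo_mulDr : right_distributive endo_mul +%R.
Proof. by move=> f g h; apply/endoP => x; exact: linearD. Qed.
Fact endo1_neq0 : endo_one != 0.
Proof.
apply/eqP => /(congr1 (fun f : endo => f 1)) /eqP.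
by rewrite [_ == _](negPf (oner_neq0 A)).
Qed.
HB.instance Definition _ := GRing.Zmodule_isNzRing.Build endo
  endo_mulA endo_mul1 endo_mulr1 endo_mulDl endo_mulDr endo1_neq0.

Fact endo_scaleA a b f : endo_scale a (endo_scale b f) = endo_scale (a * b) f.
Proof. by apply/endoP => x; exact: scalerA. Qed.
Fact endo_scale1 : left_id 1 endo_scale.
Proof. by move=> f; apply/endoP => x; exact: scale1r. Qed.
Fact endo_scaleDr : right_distributive endo_scale +%R.
Proof. by move=> c f g; apply/endoP => x; exact: scalerDr. Qed.
Fact endo_scaleDl f : {morph endo_scale^~ f : a b / a + b}.
Proof. by move=> a b; apply/endoP => x; exact: scalerDl. Qed.
HB.instance Definition _ := GRing.Zmodule_isLmodule.Build K endo
  endo_scaleA endo_scale1 endo_scaleDr endo_scaleDl.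
Fact endo_scaleAl (k : K) (f g : endo) : k *: (f * g) = (k *: f) * g.
Proof. by apply/endoP. Qed.
HB.instance Definition _ := GRing.Lmodule_isLalgebra.Build K endo endo_scaleAl.
Fact endo_scaleAr (k : K) (f g : endo) : k *: (f * g) = f * (k *: g).
Proof. by apply/endoP => x; symmetry; exact: linearZ_LR. Qed.
HB.instance Definition _ := GRing.Lalgebra_isAlgebra.Build K endo endo_scaleAr.
End Endo.

Section GenSubalg.
Variables (K : comNzRingType) (A : algType K).

(* Membership in the unital subalgebra generated by X. *)
Inductive gen_subalg (X : A -> Prop) : A -> Prop :=
| GenOne : gen_subalg X 1
| GenMem x of X x : gen_subalg X x
| GenAdd x y of gen_subalg X x & gen_subalg X y : gen_subalg X (x + y)
| GenScale k x of gen_subalg X x : gen_subalg X (k *: x)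
| GenMul x y of gen_subalg X x & gen_subalg X y : gen_subalg X (x * y).

Definition in_gen_subalg X : {pred A} := fun x => `[< gen_subalg X x >].

Fact gen_subalg_closed X : subalg_closed (in_gen_subalg X).
Proof.
split=> [|k x y|x y]; rewrite /in_mem /= /in_gen_subalg; first by apply/asboolP; constructor.
  move=> /asboolP hx /asboolP hy; apply/asboolP; constructor=> //; by constructor.
by move=> /asboolP hx /asboolP hy; apply/asboolP; constructor.
Qed.
HB.instance Definition _ X :=
  GRing.isSubalgClosed.Build K A (in_gen_subalg X) (gen_subalg_closed X).

Record subalg (X : A -> Prop) := Subalg {
  subalg_val : A; _ : subalg_val \in in_gen_subalg X }.
Arguments subalg_val {X} _.
HB.instance Definition _ X := [isSub for @subalg_val X].
HB.instance Definition _ X := [Choice of subalg X by <:].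
HB.instance Definition _ X := [SubChoice_isSubAlgebra of subalg X by <:].
End GenSubalg.

Section SubalgEndo.
Variables (K : comNzRingType) (A : algType K) (X : endo A -> Prop).
Implicit Types (p q : subalg X) (u : A).

Lemma subalg_endo1 u : subalg_val (1 : subalg X) u = u. Proof. by []. Qed.
Lemma subalg_endoD p q u : subalg_val (p + q) u = subalg_val p u + subalg_val q u.
Proof. by []. Qed.
Lemma subalg_endoZ k p u : subalg_val (k *: p) u = k *: subalg_val p u.
Proof. by []. Qed.
Lemma subalg_endoM p q u : subalg_val (p * q) u = subalg_val p (subalg_val q u).
Proof. by []. Qed.
Lemma endoZ (f : endo A) k u : f (k *: u) = k *: f u.
Proof. exact: linearZZ. Qed.
End SubalgEndo.

Section TensorDef.
Variables (K : comNzRingType) (A B : lmodType K).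

(* The tensor product over K, presented as formal sums of pairs modulo the
   bilinearity relations. *)
Inductive tens_eq : seq (A * B) -> seq (A * B) -> Prop :=
| TensRefl s : tens_eq s s
| TensSym s1 s2 of tens_eq s1 s2 : tens_eq s2 s1
| TensTrans s1 s2 s3 of tens_eq s1 s2 & tens_eq s2 s3 : tens_eq s1 s3
| TensCat s1 s2 t1 t2 of tens_eq s1 s2 & tens_eq t1 t2 :
    tens_eq (s1 ++ t1) (s2 ++ t2)
| TensPerm s1 s2 of perm_eq s1 s2 : tens_eq s1 s2
| TensDl a a' b : tens_eq [:: (a + a', b)] [:: (a, b); (a', b)]
| TensDr a b b' : tens_eq [:: (a, b + b')] [:: (a, b); (a, b')]
| TensZ k a b : tens_eq [:: (k *: a, b)] [:: (a, k *: b)]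
| Tens0 b : tens_eq [:: (0, b)] [::].

Definition tens_rel : rel (seq (A * B)) := fun s1 s2 => `[< tens_eq s1 s2 >].
Fact tens_rel_refl : reflexive tens_rel.
Proof. by move=> s; apply/asboolP/TensRefl. Qed.
Fact tens_rel_sym : symmetric tens_rel.
Proof. by move=> s t; apply/asboolP/asboolP => /TensSym. Qed.
Fact tens_rel_trans : transitive tens_rel.
Proof.
by move=> t s u /asboolP st /asboolP tu; apply/asboolP; exact: TensTrans tu.
Qed.
Canonical tens_equiv := EquivRel tens_rel tens_rel_refl tens_rel_sym tens_rel_trans.
Definition tensor : Type := {eq_quot tens_equiv}%qT.
HB.instance Definition _ := Choice.on tensor.
HB.instance Definition _ := EqQuotient.on tensor.

Definition tens_cls (s : seq (A * B)) : tensor := (\pi_tensor s)%qT.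
Definition tens_rep (x : tensor) : seq (A * B) := repr x.
Definition tens (a : A) (b : B) : tensor := tens_cls [:: (a, b)].

Lemma tens_repK x : tens_cls (tens_rep x) = x. Proof. exact: reprK. Qed.

Lemma tens_clsP s t : tens_cls s = tens_cls t <-> tens_eq s t.
Proof.
split; last by move=> st; apply/eqmodP/asboolP.
by move/eqmodP/asboolP.
Qed.

Lemma tens_clsK s : tens_eq (tens_rep (tens_cls s)) s.
Proof. by apply/tens_clsP; rewrite tens_repK. Qed.

Lemma tens_eq0r a : tens_eq [:: (a, 0)] [::].
Proof.
apply: TensTrans (Tens0 0); apply: TensSym.
by rewrite -[in X in tens_eq X _](scale0r a) -[in X in tens_eq _ X](scaler0 _ (0 : K)); apply: TensZ.
Qed.
End TensorDef.

Section TensMapSeq.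
Variables (K : comNzRingType) (A B C D : lmodType K) (f : A -> C) (g : B -> D).
Definition tens_mapseq := map (fun p : A * B => (f p.1, g p.2)).

Lemma tens_mapseqP (fl : linear f) (gl : linear g) s t :
  tens_eq s t -> tens_eq (tens_mapseq s) (tens_mapseq t).
Proof.
have fD x y : f (x + y) = f x + f y by have := fl 1 x y; rewrite !scale1r.
have gD x y : g (x + y) = g x + g y by have := gl 1 x y; rewrite !scale1r.
have f0 : f 0 = 0 by apply: (addrI (f 0)); rewrite -fD !addr0.
have g0 : g 0 = 0 by apply: (addrI (g 0)); rewrite -gD !addr0.
have fZ k x : f (k *: x) = k *: f x by have := fl k x 0; rewrite !addr0 f0 addr0.
have gZ k x : g (k *: x) = k *: g x by have := gl k x 0; rewrite !addr0 g0 addr0.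
elim => {s t} [s|s t _|s t u _ + _|s1 s2 t1 t2 _ h1 _ h2|s t st|a a' b|a b b'|k a b|b].
- exact: TensRefl.
- exact: TensSym.
- exact: TensTrans.
- by rewrite /tens_mapseq !map_cat; apply: TensCat.
- by apply: TensPerm; apply: perm_map.
- by rewrite /= fD; apply: TensDl.
- by rewrite /= gD; apply: TensDr.
- by rewrite /= fZ gZ; apply: TensZ.
- by rewrite /= f0; apply: Tens0.
Qed.

Definition tens_map (x : tensor A B) : tensor C D :=
  tens_cls (tens_mapseq (tens_rep x)).

Lemma tens_mapE (fl : linear f) (gl : linear g) s :
  tens_map (tens_cls s) = tens_cls (tens_mapseq s).
Proof. by apply/tens_clsP/tens_mapseqP => //; exact: tens_clsK. Qed.
End TensMapSeq.

Section TensorLmod.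
Variables (K : comNzRingType) (A B : lmodType K).
Local Notation T := (tensor A B).

Definition tens_zero : T := tens_cls [::].
Definition tens_add (x y : T) : T := tens_cls (tens_rep x ++ tens_rep y).
Definition tens_scale (k : K) (x : T) : T := tens_map ( *:%R k) id x.
Definition tens_opp (x : T) : T := tens_scale (- 1) x.

Lemma tens_addE s t : tens_add (tens_cls s) (tens_cls t) = tens_cls (s ++ t).
Proof. by apply/tens_clsP/TensCat; exact: tens_clsK. Qed.

Let lZ (k : K) : linear ( *:%R k : A -> A).
Proof. by move=> c x y; rewrite scalerDr !scalerA mulrC. Qed.
Let lI : linear (@id B). Proof. by []. Qed.

Lemma tens_scaleE k s :
  tens_scale k (tens_cls s) = tens_cls (tens_mapseq ( *:%R k) id s).
Proof. exact: tens_mapE. Qed.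

Fact tens_addA : associative tens_add.
Proof.
move=> x y z; rewrite -[x]tens_repK -[y]tens_repK -[z]tens_repK.
by rewrite !tens_addE catA.
Qed.
Fact tens_addC : commutative tens_add.
Proof.
move=> x y; rewrite -[x]tens_repK -[y]tens_repK !tens_addE.
by apply/tens_clsP/TensPerm; rewrite perm_catC.
Qed.
Fact tens_add0 : left_id tens_zero tens_add.
Proof. by move=> x; rewrite -[x]tens_repK tens_addE. Qed.
Fact tens_addN : left_inverse tens_zero tens_opp tens_add.
Proof.
move=> x; rewrite -[x]tens_repK /tens_opp tens_scaleE tens_addE.
apply/tens_clsP; elim: (tens_rep x) => [|[a b] s IHs]; first exact: TensRefl.
rewrite /= scaleN1r; apply: (@TensTrans _ _ _ _ ([:: (- a, b); (a, b)] ++ (tens_mapseq ( *:%R (- 1)) id s ++ s))).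
  apply: TensPerm; rewrite /= perm_cons -cat1s perm_catCA /=.
  exact: perm_refl.
rewrite -[[::]]cats0; apply: TensCat => //.
apply: TensTrans (TensSym (TensDl _ _ _)) _; rewrite addNr; exact: Tens0.
Qed.
HB.instance Definition _ := GRing.isZmodule.Build T
  tens_addA tens_addC tens_add0 tens_addN.

Fact tens_scaleA j k (x : T) : tens_scale j (tens_scale k x) = tens_scale (j * k) x.
Proof.
rewrite -[x]tens_repK !tens_scaleE /tens_mapseq -map_comp.
by congr tens_cls; apply: eq_map => -[a b]; rewrite /= scalerA.
Qed.
Fact tens_scale1 : left_id 1 tens_scale.
Proof.
move=> x; rewrite -[x]tens_repK tens_scaleE; congr tens_cls.
by rewrite -[RHS]map_id; apply: eq_map => -[a b]; rewrite /= scale1r.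
Qed.
Fact tens_scaleDr : right_distributive tens_scale +%R.
Proof.
move=> k x y; rewrite -[x]tens_repK -[y]tens_repK.
by rewrite [_ + _]tens_addE !tens_scaleE [RHS]tens_addE /tens_mapseq map_cat.
Qed.
Fact tens_scaleDl (x : T) : {morph tens_scale^~ x : j k / j + k}.
Proof.
move=> j k; rewrite -[x]tens_repK !tens_scaleE [RHS]tens_addE.
apply/tens_clsP; elim: (tens_rep x) => [|[a b] s IHs]; first exact: TensRefl.
rewrite /= scalerDl.
apply: (@TensTrans _ _ _ _ ([:: (j *: a, b); (k *: a, b)] ++
  (tens_mapseq ( *:%R j) id s ++ tens_mapseq ( *:%R k) id s))).
  rewrite -[X in tens_eq X]cat1s; apply: TensCat => //; exact: TensDl.
apply: TensPerm; rewrite /= perm_cons -cat1s perm_catCA /=.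
exact: perm_refl.
Qed.
HB.instance Definition _ := GRing.Zmodule_isLmodule.Build K T
  tens_scaleA tens_scale1 tens_scaleDr tens_scaleDl.

Lemma tensDl a a' b : tens (a + a') b = tens a b + tens a' b :> T.
Proof. by rewrite [RHS]tens_addE; apply/tens_clsP/TensDl. Qed.
Lemma tensDr a b b' : tens a (b + b') = tens a b + tens a b' :> T.
Proof. by rewrite [RHS]tens_addE; apply/tens_clsP/TensDr. Qed.
Lemma tensZl k a b : tens (k *: a) b = k *: tens a b :> T.
Proof. by rewrite [RHS]tens_scaleE. Qed.
Lemma tensZr k a b : tens a (k *: b) = k *: tens a b :> T.
Proof. by rewrite -tensZl; apply/tens_clsP/TensSym/TensZ. Qed.
Lemma tens_cls_sum s : tens_cls s = \sum_(p <- s) tens p.1 p.2 :> T.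
Proof.
elim: s => [|[a b] s IHs]; first by rewrite big_nil.
by rewrite big_cons -IHs [RHS]tens_addE.
Qed.
End TensorLmod.

Section TensorLift.
Variables (K : comNzRingType) (A B V : lmodType K) (phi : A -> B -> V).
Hypothesis phil : forall b, linear (phi^~ b).
Hypothesis phir : forall a, linear (phi a).

Definition tens_lift (x : tensor A B) : V := \sum_(p <- tens_rep x) phi p.1 p.2.

Lemma tens_liftE s : tens_lift (tens_cls s) = \sum_(p <- s) phi p.1 p.2.
Proof.
suff H t u : tens_eq t u ->
  \sum_(p <- t) phi p.1 p.2 = \sum_(p <- u) phi p.1 p.2 by exact/H/tens_clsK.
have Dl b a a' : phi (a + a') b = phi a b + phi a' b.
  by have := phil b 1 a a'; rewrite !scale1r.
have Dr a b b' : phi a (b + b') = phi a b + phi a b'.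
  by have := phir a 1 b b'; rewrite !scale1r.
have l0 b : phi 0 b = 0 by apply: (addrI (phi 0 b)); rewrite -Dl !addr0.
have r0 a : phi a 0 = 0 by apply: (addrI (phi a 0)); rewrite -Dr !addr0.
elim => {t u} [//|s1 s2 _ //|s1 s2 s3 _ -> _ -> //|s1 s2 t1 t2 _ h1 _ h2|s1 s2|a a' b|a b b'|k a b|b].
- by rewrite !big_cat h1 h2.
- exact: perm_big.
- by rewrite !big_cons big_nil !addr0 Dl.
- by rewrite !big_cons big_nil !addr0 Dr.
- rewrite !big_seq1 /=; have := phil b k a 0; have := phir a k b 0.
  by rewrite !addr0 l0 r0 !addr0 => -> ->.
- by rewrite big_seq1 big_nil /= l0.
Qed.

Lemma tens_lift_tens a b : tens_lift (tens a b) = phi a b.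
Proof. by rewrite tens_liftE big_seq1. Qed.
End TensorLift.

Section TensorRing.
Variables (K : comNzRingType) (A B : algType K).
Local Notation T := (tensor A B).

Definition tens_mulseq (s t : seq (A * B)) : seq (A * B) :=
  [seq (p.1 * q.1, p.2 * q.2) | p <- s, q <- t].

Let mulseq_catl s1 s2 t : tens_mulseq (s1 ++ s2) t = tens_mulseq s1 t ++ tens_mulseq s2 t.
Proof. exact: allpairs_cat. Qed.

Let lL (R : algType K) (a : R) : linear ( *%R a).
Proof. by move=> k x y; rewrite mulrDr scalerAr. Qed.
Let lR (R : algType K) (a : R) : linear ( *%R^~ a).
Proof. by move=> k x y; rewrite mulrDl scalerAl. Qed.

Lemma tens_mulseq_eqr s t t' : tens_eq t t' -> tens_eq (tens_mulseq s t) (tens_mulseq s t').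
Proof.
move=> tt; elim: s => [|[a b] s IHs]; first exact: TensRefl.
by rewrite /tens_mulseq /=; apply: TensCat => //; exact: (tens_mapseqP (lL a) (lL b)).
Qed.

Lemma tens_mulseq_swap s t :
  perm_eq (tens_mulseq s t) (flatten [seq tens_mapseq ( *%R^~ q.1) ( *%R^~ q.2) s | q <- t]).
Proof.
elim: t => [|q t IHt]; first by rewrite /tens_mulseq allpairs0r.
rewrite /tens_mulseq.
by rewrite (perm_allpairs_consr _ s (fun=> q) (fun=> t)) /= perm_cat2l.
Qed.

Lemma tens_mulseq_eql s s' t : tens_eq s s' -> tens_eq (tens_mulseq s t) (tens_mulseq s' t).
Proof.
move=> ss; apply: TensTrans (TensPerm (tens_mulseq_swap s t)) _.
apply: TensTrans (TensSym (TensPerm (tens_mulseq_swap s' t))).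
elim: t => [|[a b] t IHt]; first exact: TensRefl.
by apply: TensCat => //; exact: (tens_mapseqP (lR a) (lR b)).
Qed.

Definition tens_one : T := tens 1 1.
Definition tens_mul (x y : T) : T := tens_cls (tens_mulseq (tens_rep x) (tens_rep y)).

Lemma tens_mulE s t : tens_mul (tens_cls s) (tens_cls t) = tens_cls (tens_mulseq s t).
Proof.
apply/tens_clsP; apply: TensTrans (tens_mulseq_eql _ (tens_clsK _)) _.
exact: tens_mulseq_eqr (tens_clsK _).
Qed.

Let mulseq_cons p s t :
  tens_mulseq (p :: s) t = tens_mapseq ( *%R p.1) ( *%R p.2) t ++ tens_mulseq s t.
Proof. by []. Qed.

Let mapseq_mul (a : A) (b : B) t u :
  tens_mapseq ( *%R a) ( *%R b) (tens_mulseq t u) =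
  tens_mulseq (tens_mapseq ( *%R a) ( *%R b) t) u.
Proof.
elim: t => [//|p t IHt].
rewrite [tens_mapseq _ _ (p :: t)]/= !mulseq_cons -IHt /tens_mapseq map_cat.
congr cat; rewrite -map_comp.
by apply: eq_map => q; rewrite /= !mulrA.
Qed.

Fact tens_mulA : associative tens_mul.
Proof.
move=> x y z; rewrite -[x]tens_repK -[y]tens_repK -[z]tens_repK !tens_mulE.
congr tens_cls; elim: (tens_rep x) => [//|p s IHs].
by rewrite !mulseq_cons mulseq_catl IHs mapseq_mul.
Qed.
Fact tens_mul1 : left_id tens_one tens_mul.
Proof.
move=> x; rewrite -[x]tens_repK tens_mulE /tens_mulseq /= cats0.
by congr tens_cls; rewrite -[RHS]map_id; apply: eq_map => -[a b]; rewrite /= !mul1r.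
Qed.
Fact tens_mulr1 : right_id tens_one tens_mul.
Proof.
move=> x; rewrite -[x]tens_repK tens_mulE; congr tens_cls.
elim: (tens_rep x) => [//|[a b] s IHs].
by rewrite mulseq_cons /tens_mapseq /= IHs !mulr1.
Qed.
Fact tens_mulDl : left_distributive tens_mul +%R.
Proof.
move=> x y z; rewrite -[x]tens_repK -[y]tens_repK -[z]tens_repK.
by rewrite [_ + _]tens_addE !tens_mulE [RHS]tens_addE mulseq_catl.
Qed.
Fact tens_mulDr : right_distributive tens_mul +%R.
Proof.
move=> x y z; rewrite -[x]tens_repK -[y]tens_repK -[z]tens_repK.
rewrite [_ + _]tens_addE !tens_mulE [RHS]tens_addE; apply/tens_clsP/TensPerm.
rewrite (permPl (tens_mulseq_swap _ _)) map_cat flatten_cat.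
by rewrite perm_sym perm_cat // tens_mulseq_swap.
Qed.
HB.instance Definition _ := GRing.Zmodule_isPzRing.Build T
  tens_mulA tens_mul1 tens_mulr1 tens_mulDl tens_mulDr.

Lemma tensM a a' b b' : tens (a * a') (b * b') = tens a b * tens a' b' :> T.
Proof. by rewrite [RHS]tens_mulE. Qed.
Lemma tens_scaleAl k (x y : T) : k *: (x * y) = (k *: x) * y.
Proof.
rewrite -[x]tens_repK -[y]tens_repK [_ * _]tens_mulE ![_ *: _]tens_scaleE.
rewrite [RHS]tens_mulE; congr tens_cls; rewrite /tens_mulseq /tens_mapseq.
rewrite allpairs_mapl map_allpairs; congr flatten; apply: eq_map => -[a b].
by apply: eq_map => -[a' b']; rewrite /= scalerAl.
Qed.
Lemma tens_scaleAr k (x y : T) : k *: (x * y) = x * (k *: y).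
Proof.
rewrite -[x]tens_repK -[y]tens_repK [_ * _]tens_mulE ![_ *: _]tens_scaleE.
rewrite [RHS]tens_mulE; congr tens_cls; rewrite /tens_mulseq /tens_mapseq.
rewrite allpairs_mapr map_allpairs; congr flatten; apply: eq_map => -[a b].
by apply: eq_map => -[a' b']; rewrite /= scalerAr.
Qed.
End TensorRing.

Lemma fps_tmonE (R : nzRingType) (u v : fps tmon R) (k : nat) :
  (u * v) k = \sum_(i < k.+1) u i * v (k - i)%N.
Proof.
have degE (m : tmon) : zdeg m = m by exact: size_nseq.
have pZ : perm_eq (zmons tmon k) (iota 0 k.+1).
  apply: uniq_perm; rewrite ?zmons_uniq ?iota_uniq // => m.
  by rewrite mem_zmons degE mem_iota.
rewrite [LHS]fps_mulE degE (perm_big _ pZ) -[iota 0 k.+1]/(index_iota 0 k.+1) /=.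
rewrite big_mkord; apply: eq_bigr => i _; rewrite (perm_big _ pZ).
rewrite (@big_only _ _ _ (k - i)%N) ?iota_uniq ?mem_iota ?ltnS ?leq_subr // => b.
by rewrite /= -[LHS]/(i + b == k)%N; rewrite -(eqn_add2l i b) subnKC // -ltnS.
Qed.

Section CourseOfValues.
Variables (B : pzRingType) (step : nat -> (nat -> B) -> B).

Fixpoint crec_seq (m : nat) : seq B :=
  if m is k.+1 then
    let s := crec_seq k in rcons s (step k.+1 (nth 0 s))
  else [:: 1].

Definition crec (m : nat) : B := nth 0 (crec_seq m) m.

Lemma size_crec_seq m : size (crec_seq m) = m.+1.
Proof. by elim: m => //= m; rewrite size_rcons => ->. Qed.

Lemma nth_crec_seq m i : (i <= m)%N -> nth 0 (crec_seq m) i = crec i.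
Proof.
elim: m => [|m IHm]; first by rewrite leqn0 => /eqP->.
rewrite leq_eqVlt => /predU1P[-> //|im].
by rewrite /= nth_rcons size_crec_seq im IHm.
Qed.

Lemma crecE m :
  (forall f g, (forall i, (i <= m)%N -> f i = g i) -> step m.+1 f = step m.+1 g) ->
  crec m.+1 = step m.+1 crec.
Proof.
move=> loc; rewrite {1}/crec /= nth_rcons size_crec_seq ltnn eqxx.
by apply: loc => i; exact: nth_crec_seq.
Qed.
End CourseOfValues.

Section ChangeOfGenerators.
Variable B : pzRingType.
Implicit Types (l s p : nat -> B).

(* With s m, l m, p m the coefficients of sigma(t), lambda(t) and psi(t):
   the first two recursions solve sigma(t) * lambda(-t) = 1 for s and for l, the
   third solves sigma'(t) = sigma(t) * psi(t) for p; p 0 is a dummy value. *)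
Definition sigma_of_lambda l : nat -> B :=
  crec (fun m s => - \sum_(j < m) s j * ((-1) ^+ (m - j) * l (m - j)%N)).

Definition lambda_of_sigma s : nat -> B :=
  crec (fun m l =>
    (-1) ^+ m * - \sum_(j < m) s (m - j)%N * ((-1) ^+ j * l j)).

Definition psi_of_sigma s : nat -> B :=
  crec (fun m p => m%:R * s m - \sum_(1 <= i < m) s (m - i)%N * p i).

Lemma sigma_of_lambda0 l : sigma_of_lambda l 0%N = 1. Proof. by []. Qed.

Lemma sigma_of_lambdaS l m : sigma_of_lambda l m.+1 =
  - \sum_(j < m.+1) sigma_of_lambda l j * ((-1) ^+ (m.+1 - j) * l (m.+1 - j)%N).
Proof.
apply: crecE => f g fg; congr (- _); apply: eq_bigr => j _.
by rewrite fg // -ltnS.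
Qed.

Lemma lambda_of_sigmaS s m : lambda_of_sigma s m.+1 = (-1) ^+ m.+1 *
  - \sum_(j < m.+1) s (m.+1 - j)%N * ((-1) ^+ j * lambda_of_sigma s j).
Proof.
apply: crecE => f g fg; congr (_ * - _); apply: eq_bigr => j _.
by rewrite fg // -ltnS.
Qed.

Lemma psi_of_sigmaS s m : psi_of_sigma s m.+1 =
  m.+1%:R * s m.+1 - \sum_(1 <= i < m.+1) s (m.+1 - i)%N * psi_of_sigma s i.
Proof.
apply: crecE => f g fg; congr (_ - _).
rewrite !big_nat; apply: eq_bigr => i /andP[_ im].
by rewrite fg // -ltnS.
Qed.

Lemma lambda_of_sigma_eq s m :
  \sum_(j < m.+2) s (m.+1 - j)%N * ((-1) ^+ j * lambda_of_sigma s j) =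
  (s 0%N - 1) * ((-1) ^+ m.+1 * lambda_of_sigma s m.+1).
Proof.
rewrite big_ord_recr /= subnn mulrBl mul1r [RHS]addrC; congr (_ + _).
by rewrite lambda_of_sigmaS mulrA -exprD addnn -mul2n exprM sqrrN expr1n expr1n mul1r opprK.
Qed.

Lemma lambda_of_sigmaK s : s 0%N = 1 -> sigma_of_lambda (lambda_of_sigma s) =1 s.
Proof.
move=> s0 m; elim/ltn_ind: m => -[//|m] IH.
rewrite sigma_of_lambdaS; have := lambda_of_sigma_eq s m.
rewrite s0 subrr mul0r big_ord_recl /= subn0 mul1r {1}/lambda_of_sigma {1}/crec /= mulr1.
move/eqP; rewrite addr_eq0 => /eqP->; congr (- _).
rewrite (reindex_inj rev_ord_inj) /=; apply: eq_bigr => j _.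
rewrite subSS IH; last by rewrite ltnS leq_subr.
by rewrite subSn ?leq_subr // subKn // -ltnS.
Qed.
End ChangeOfGenerators.

Section NSym.
Variable K : comAlgType rat.

(* The letter i of the free monoid stands for Lambda_(i+1). *)
Definition nsym : Type := {malg K[{fmonom nat}]}.
HB.instance Definition _ := GRing.Lalgebra.on nsym.

Fact nsym_scaleAr (k : K) (x y : nsym) : k *: (x * y) = x * (k *: y).
Proof.
suff H : x * k%:MP = k%:MP * x by rewrite -!mul_malgC mulrA -H -mulrA.
rewrite /GRing.mul /= fgmulUg fgmulgU; apply: eq_bigr => w _.
by rewrite mul1m mulm1 mulrC.
Qed.
HB.instance Definition _ := GRing.Lalgebra_isAlgebra.Build K nsym nsym_scaleAr.

Definition nLambda (m : nat) : nsym := if m is i.+1 then << fmu i >> else 1.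
Definition nS : nat -> nsym := sigma_of_lambda nLambda.
Definition nPsi : nat -> nsym := psi_of_sigma nS.

Lemma nS_gen :
  (nS : fps tmon nsym) * (fun j : tmon => (-1) ^+ (j : nat) * nLambda j) = 1.
Proof.
apply/funext => m; rewrite fps_tmonE.
case: m => [|m]; first by rewrite big_ord1 /= /nS sigma_of_lambda0 !mul1r.
rewrite big_ord_recr /= subnn mulr1 [X in _ + X]mulr1 [X in _ + X]sigma_of_lambdaS.
exact: addrN.
Qed.

Lemma nPsi_gen m :
  m.+1%:R * nS m.+1 = \sum_(i < m.+1) nS (m - i)%N * nPsi i.+1.
Proof.
rewrite big_ord_recr /= subnn mul1r [nPsi m.+1]psi_of_sigmaS big_add1 /= big_mkord.
by rewrite addrC -addrA addNr addr0.
Qed.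

Section Lift.
Variables (B : pzRingType) (c : {rmorphism K -> B}).

(* The K-algebra maps out of nsym given by the images of the free generators
   Lambda_m (nsym_lift), S_m (sigma_lift) or Psi_m (psi_lift), for m >= 1.
   c is the structure map of the K-algebra B; values at index 0 of sequences of
   generators are not used, or are 1. *)
Definition nsym_lift (l : nat -> B) (g : nsym) : B :=
  \sum_(w <- msupp g) c (g@_w) * \prod_(i <- (w : seq nat)) l i.+1.

Definition sigma_of_psi (p : nat -> B) : nat -> B :=
  crec (fun m s => c (in_alg K m%:R^-1) * \sum_(1 <= i < m.+1) s (m - i)%N * p i).

Definition sigma_lift (s : nat -> B) : nsym -> B := nsym_lift (lambda_of_sigma s).
Definition psi_lift (p : nat -> B) : nsym -> B := sigma_lift (sigma_of_psi p).

Hypothesis cC : forall k x, c k * x = x * c k.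

Lemma nsym_liftEw l (d : {fset {fmonom nat}}) g : (msupp g `<=` d)%fset ->
  nsym_lift l g = \sum_(w <- d) c (g@_w) * \prod_(i <- (w : seq nat)) l i.+1.
Proof.
move=> le; rewrite /nsym_lift [LHS](big_fset_incl _ le) //= => w _ /mcoeff_outdom ->.
by rewrite rmorph0 mul0r.
Qed.

Lemma nsym_liftU l k w :
  nsym_lift l << k *g w >> = c k * \prod_(i <- (w : seq nat)) l i.+1.
Proof. by rewrite (nsym_liftEw _ msuppU_le) big_seq_fset1 mcoeffUU. Qed.

Lemma nsym_liftB l : {morph nsym_lift l : x y / x - y}.
Proof.
move=> x y; set d := (msupp x `|` msupp y)%fset.
have xd : (msupp x `<=` d)%fset by exact: fsubsetUl.
have yd : (msupp y `<=` d)%fset by exact: fsubsetUr.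
rewrite !(@nsym_liftEw l d) // -?sumrB; last first.
  apply/fsubsetP => w; apply: contraLR => wd; rewrite -mcoeff_eq0 mcoeffB.
  have wx : w \notin msupp x by apply: contra wd; apply: (fsubsetP xd).
  have wy : w \notin msupp y by apply: contra wd; apply: (fsubsetP yd).
  by rewrite !mcoeff_outdom // subr0.
by apply: eq_bigr => w _; rewrite mcoeffB rmorphB mulrBl.
Qed.

Lemma nsym_liftZ l k x : nsym_lift l (k *: x) = c k * nsym_lift l x.
Proof.
rewrite (nsym_liftEw _ (msuppZ_le _ _)) mulr_sumr; apply: eq_bigr => w _.
by rewrite mcoeffZ rmorphM mulrA.
Qed.

Lemma nsym_lift1 l : nsym_lift l 1 = 1.
Proof. by rewrite nsym_liftU rmorph1 fm1 big_nil mulr1. Qed.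

Lemma nsym_lift0 l : nsym_lift l 0 = 0.
Proof. by rewrite -(subrr 0) nsym_liftB subrr. Qed.
Lemma nsym_liftD l : {morph nsym_lift l : x y / x + y}.
Proof.
move=> x y; have -> : x + y = x - (0 - y) by rewrite sub0r opprK.
by rewrite !nsym_liftB nsym_lift0 sub0r opprK.
Qed.

Lemma nsym_lift_sum l (I : Type) (r : seq I) (P : pred I) (F : I -> nsym) :
  nsym_lift l (\sum_(i <- r | P i) F i) = \sum_(i <- r | P i) nsym_lift l (F i).
Proof. exact: (big_morph _ (nsym_liftD l) (nsym_lift0 l)). Qed.

Lemma nsym_liftM l : {morph nsym_lift l : x y / x * y}.
Proof.
move=> x y; rewrite malgME nsym_lift_sum mulr_suml; apply: eq_bigr => v _.
rewrite nsym_lift_sum mulr_sumr; apply: eq_bigr => w _.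
by rewrite nsym_liftU fmM big_cat /= rmorphM -!mulrA; congr (_ * _); rewrite !mulrA cC.
Qed.

Lemma nsym_lift_Lambda l m : l 0%N = 1 -> nsym_lift l (nLambda m) = l m.
Proof.
by case: m => [|m] l0; rewrite ?nsym_lift1 // nsym_liftU rmorph1 mul1r fmU big_seq1.
Qed.

Lemma nsym_liftX_sign l m : nsym_lift l ((-1) ^+ m) = (-1) ^+ m.
Proof.
elim: m => [|m IHm]; first exact: nsym_lift1.
rewrite !exprS nsym_liftM IHm; congr (_ * _).
by rewrite -sub0r nsym_liftB nsym_lift0 nsym_lift1 sub0r.
Qed.

Lemma nsym_lift_S l m : l 0%N = 1 -> nsym_lift l (nS m) = sigma_of_lambda l m.
Proof.
move=> l0; elim/ltn_ind: m => -[_|m IH]; first exact: nsym_lift1.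
rewrite [nS _]sigma_of_lambdaS sigma_of_lambdaS -sub0r nsym_liftB nsym_lift0 sub0r.
congr (- _); rewrite nsym_lift_sum; apply: eq_bigr => j _.
by rewrite !nsym_liftM nsym_liftX_sign nsym_lift_Lambda // IH.
Qed.

Lemma sigma_lift_S s m : s 0%N = 1 -> sigma_lift s (nS m) = s m.
Proof. by move=> s0; rewrite /sigma_lift nsym_lift_S // lambda_of_sigmaK. Qed.

Lemma sigma_of_psiS p m : sigma_of_psi p m.+1 =
  c (in_alg K m.+1%:R^-1) * \sum_(1 <= i < m.+2) sigma_of_psi p (m.+1 - i)%N * p i.
Proof.
apply: crecE => f g fg; congr (_ * _).
rewrite !big_nat; apply: eq_bigr => -[//|i] /andP[_ im].
by rewrite fg // subSS leq_subr.
Qed.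

Lemma psi_lift_Psi p m : psi_lift p (nPsi m.+1) = p m.+1.
Proof.
have S0 : sigma_of_psi p 0%N = 1 by [].
elim/ltn_ind: m => m IH.
rewrite [nPsi _]psi_of_sigmaS /psi_lift /sigma_lift nsym_liftB nsym_liftM.
rewrite -/(sigma_lift _ _) -/(sigma_lift _ _) sigma_lift_S //.
have -> : sigma_lift (sigma_of_psi p) m.+1%:R = m.+1%:R.
  elim: m.+1 => [|k IHk]; first exact: nsym_lift0.
  by rewrite -natr1 [LHS]nsym_liftD [X in X + _]IHk nsym_lift1 natr1.
rewrite sigma_of_psiS -(rmorph_nat c) mulrA -rmorphM.
have -> : m.+1%:R * in_alg K m.+1%:R^-1 = 1.
  rewrite -(rmorph_nat (in_alg K)) -rmorphM mulfV ?rmorph1 //.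
  by rewrite Num.Theory.pnatr_eq0.
rewrite rmorph1 mul1r big_nat_recr //= subnn S0 mul1r nsym_lift_sum.
rewrite addrAC [X in X - _](_ : _ = \sum_(1 <= i < m.+1) nsym_lift (lambda_of_sigma (sigma_of_psi p)) (nS (m.+1 - i) * nPsi i)); first by rewrite subrr add0r.
rewrite !big_nat; apply: eq_bigr => -[//|i] /andP[_ im].
rewrite nsym_liftM -/(sigma_lift _ _) -/(sigma_lift _ _) sigma_lift_S //.
by congr (_ * _); rewrite -[LHS](IH i).
Qed.
End Lift.

Section LRLift.
Variable B : algType K.
Let cB : {rmorphism K -> B} := in_alg B.
Let cBC k x : cB k * x = x * cB k.
Proof. by rewrite /cB /= mulr_algl mulr_algr. Qed.

Fact nsym_lift_is_lrmorphism (l : nat -> B) :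
  [/\ zmod_morphism (nsym_lift cB l), monoid_morphism (nsym_lift cB l)
    & scalable (nsym_lift cB l)].
Proof.
split=> [x y||k x]; first exact: nsym_liftB.
  by split=> [|x y]; rewrite ?nsym_lift1 ?nsym_liftM.
by rewrite nsym_liftZ /cB /= mulr_algl.
Qed.

Definition nsym_hom (l : nat -> B) : {lrmorphism nsym -> B} :=
  HB.pack (nsym_lift cB l)
    (GRing.isZmodMorphism.Build _ _ _ (let: And3 h _ _ := nsym_lift_is_lrmorphism l in h))
    (GRing.isMonoidMorphism.Build _ _ _ (let: And3 _ h _ := nsym_lift_is_lrmorphism l in h))
    (GRing.isScalable.Build _ _ _ _ _ (let: And3 _ _ h := nsym_lift_is_lrmorphism l in h)).

(* The product transported from sequences of divided powers: conv T1 T2 is the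
   algebra map whose value on sigma(t) is T1(sigma(t)) * T2(sigma(t)), see conv_S.
   It is defined on all algebra maps; see hopf_homs for the Hopf ones. *)
Definition conv (T1 T2 : {lrmorphism nsym -> B}) : {lrmorphism nsym -> B} :=
  nsym_hom (lambda_of_sigma
    (fun m => \sum_(i < m.+1) T1 (nS i) * T2 (nS (m - i)%N))).

Lemma conv_S T1 T2 m :
  conv T1 T2 (nS m) = \sum_(i < m.+1) T1 (nS i) * T2 (nS (m - i)%N).
Proof.
apply: (sigma_lift_S cBC).
by rewrite big_ord1 !rmorph1 mulr1.
Qed.
End LRLift.

Section HopfNSym.

Definition tens_const (A : algType K) (k : K) : tensor A A := k *: (1 : tensor A A).
Fact tens_const_zmod A : zmod_morphism (@tens_const A).
Proof. by move=> x y; rewrite /tens_const scalerBl. Qed.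
Fact tens_const_monoid A : monoid_morphism (@tens_const A).
Proof.
split=> [|x y]; rewrite /tens_const ?scale1r //.
by rewrite -tens_scaleAl mul1r scalerA.
Qed.
HB.instance Definition _ (A : algType K) :=
  GRing.isZmodMorphism.Build K (tensor A A) (@tens_const A) (tens_const_zmod A).
HB.instance Definition _ (A : algType K) :=
  GRing.isMonoidMorphism.Build K (tensor A A) (@tens_const A) (tens_const_monoid A).

Definition conv_const (A : algType K) (k : K) : GRing.converse A := k%:A.
Fact conv_const_zmod A : zmod_morphism (@conv_const A).
Proof. by move=> x y; rewrite /conv_const scalerBl. Qed.
Fact conv_const_monoid A : monoid_morphism (@conv_const A).
Proof.
split=> [|x y]; rewrite /conv_const ?scale1r //.
transitivity ((y%:A : A) * (x%:A : A)); last by [].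
by rewrite mulr_algl scalerA mulrC.
Qed.
HB.instance Definition _ (A : algType K) :=
  GRing.isZmodMorphism.Build K (GRing.converse A) (@conv_const A) (conv_const_zmod A).
HB.instance Definition _ (A : algType K) :=
  GRing.isMonoidMorphism.Build K (GRing.converse A) (@conv_const A) (conv_const_monoid A).

Definition primitive_tens (A : algType K) (x : A) : tensor A A :=
  tens 1 x + tens x 1.

(* The Hopf structure of nsym for which the Psi_m are primitive; the antipode is
   an algebra map into the opposite algebra. *)
Definition nsym_coprod : nsym -> tensor nsym nsym :=
  psi_lift (@tens_const nsym) (fun m => primitive_tens (nPsi m)).

Definition nsym_counit : nsym -> K := psi_lift idfun (fun=> 0).

Definition nsym_antipode : nsym -> nsym :=
  psi_lift (@conv_const nsym) (fun m => - nPsi m : GRing.converse nsym).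

Let tC (A : algType K) k (x : tensor A A) : tens_const A k * x = x * tens_const A k.
Proof. by rewrite /tens_const -tens_scaleAl -tens_scaleAr mul1r mulr1. Qed.

Lemma nsym_coprodM : {morph nsym_coprod : x y / x * y}.
Proof. exact: (nsym_liftM (@tC nsym)). Qed.
Lemma nsym_coprod1 : nsym_coprod 1 = 1.
Proof. exact: nsym_lift1. Qed.
Lemma nsym_coprod_linear : linear nsym_coprod.
Proof.
move=> k x y; rewrite [LHS]nsym_liftD; congr (_ + _).
transitivity (tens_const nsym k * nsym_coprod x); first exact: nsym_liftZ.
by rewrite /tens_const -tens_scaleAl mul1r.
Qed.
Lemma nsym_coprod_Psi m : nsym_coprod (nPsi m.+1) =
  tens 1 (nPsi m.+1) + tens (nPsi m.+1) 1.
Proof. exact: (psi_lift_Psi (@tC nsym)). Qed.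

Lemma nsym_counit_Psi m : nsym_counit (nPsi m.+1) = 0.
Proof. by apply: psi_lift_Psi => k x; exact: mulrC. Qed.
Lemma nsym_counitM : {morph nsym_counit : x y / x * y}.
Proof. by apply: nsym_liftM => k x; exact: mulrC. Qed.

Let cC (k : K) (x : GRing.converse nsym) :
  conv_const nsym k * x = x * conv_const nsym k.
Proof.
transitivity ((x : nsym) * (k%:A : nsym)); first by [].
by rewrite mulr_algr -mulr_algl.
Qed.
Lemma nsym_antipode_Psi m : nsym_antipode (nPsi m.+1) = - nPsi m.+1.
Proof. exact: (psi_lift_Psi cC). Qed.
Lemma nsym_antipodeM x y :
  nsym_antipode (x * y) = nsym_antipode y * nsym_antipode x.
Proof.
rewrite /nsym_antipode /psi_lift /sigma_lift; set l := lambda_of_sigma _.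
have := nsym_liftM cC l x y.
set a := nsym_lift _ _ x.
set b := nsym_lift _ _ y.
move=> ->.
by case: a; case: b.
Qed.

End HopfNSym.

Section HopfRel.
Variables (A : algType K) (P : A -> Prop).

(* The Hopf structure that a K-algebra A generated by P inherits from the free
   algebra (or the enveloping algebra) on P, for which the elements of P are
   primitive. coprod_rel x a says that a is the coproduct of some expression of x
   as a noncommutative polynomial in P, computed with the rule
   Delta(p) = 1 (x) p + p (x) 1; likewise for the counit and the antipode.
   If this rule extends to an algebra map Delta, then coprod_rel is the graph of
   Delta (coprod_relP). It does not extend for the differential operators in
   commuting variables: with a = z_2^(alpha+1) d_1, b = z_2^alpha d_1 and
   c = z_2^(alpha+2) d_1, where d_1 is the derivative in z_1, one has a^2 = c b,
   but the rule gives different tensors over K for both sides. In that case the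
   relations are the images of the operations of the enveloping algebra of the
   Lie algebra of derivations. *)
Inductive coprod_rel : A -> tensor A A -> Prop :=
| CoprodOne : coprod_rel 1 1
| CoprodGen x of P x : coprod_rel x (tens 1 x + tens x 1)
| CoprodAdd x y a b of coprod_rel x a & coprod_rel y b : coprod_rel (x + y) (a + b)
| CoprodScale k x a of coprod_rel x a : coprod_rel (k *: x) (k *: a)
| CoprodMul x y a b of coprod_rel x a & coprod_rel y b : coprod_rel (x * y) (a * b).

Inductive counit_rel : A -> K -> Prop :=
| CounitOne : counit_rel 1 1
| CounitGen x of P x : counit_rel x 0
| CounitAdd x y a b of counit_rel x a & counit_rel y b : counit_rel (x + y) (a + b)
| CounitScale k x a of counit_rel x a : counit_rel (k *: x) (k * a)
| CounitMul x y a b of counit_rel x a & counit_rel y b : counit_rel (x * y) (a * b).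

Inductive antipode_rel : A -> A -> Prop :=
| AntipodeOne : antipode_rel 1 1
| AntipodeGen x of P x : antipode_rel x (- x)
| AntipodeAdd x y a b of antipode_rel x a & antipode_rel y b :
    antipode_rel (x + y) (a + b)
| AntipodeScale k x a of antipode_rel x a : antipode_rel (k *: x) (k *: a)
| AntipodeMul x y a b of antipode_rel x a & antipode_rel y b :
    antipode_rel (x * y) (b * a).

Lemma coprod_relP (Delta : A -> tensor A A) :
  (forall x, gen_subalg P x) ->
  Delta 1 = 1 -> linear Delta -> {morph Delta : x y / x * y} ->
  (forall x, P x -> Delta x = tens 1 x + tens x 1) ->
  forall x a, coprod_rel x a <-> a = Delta x.
Proof.
move=> gen D1 Dl DM DP.
have DD x y : Delta (x + y) = Delta x + Delta y by have := Dl 1 x y; rewrite !scale1r.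
have D0 : Delta 0 = 0 by apply: (addrI (Delta 0)); rewrite -DD !addr0.
have DZ k x : Delta (k *: x) = k *: Delta x by have := Dl k x 0; rewrite !addr0 D0 addr0.
move=> x a; split=> [|->].
  elim=> {x a} [//|x Px|x y a b _ -> _ ->|k x a _ ->|x y a b _ -> _ ->] //.
  by rewrite DP.
elim: {x} (gen x) => [|x Px|x y _ hx _ hy|k x _ hx|x y _ hx _ hy].
- by rewrite D1; constructor.
- by rewrite DP //; constructor.
- by rewrite DD; constructor.
- by rewrite DZ; constructor.
- by rewrite DM; constructor.
Qed.

Definition is_hopf_hom : set {lrmorphism nsym -> A} := fun T =>
  [/\ forall x, coprod_rel (T x) (tens_map T T (nsym_coprod x)),
      forall x, counit_rel (T x) (nsym_counit x) &
      forall x, antipode_rel (T x) (T (nsym_antipode x))].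

Lemma antipode_relP (S : A -> A) :
  (forall x, gen_subalg P x) ->
  S 1 = 1 -> linear S -> (forall x y, S (x * y) = S y * S x) ->
  (forall x, P x -> S x = - x) ->
  forall x a, antipode_rel x a <-> a = S x.
Proof.
move=> gen S1 Sl SM SP.
have SD x y : S (x + y) = S x + S y by have := Sl 1 x y; rewrite !scale1r.
have S0 : S 0 = 0 by apply: (addrI (S 0)); rewrite -SD !addr0.
have SZ k x : S (k *: x) = k *: S x by have := Sl k x 0; rewrite !addr0 S0 addr0.
move=> x a; split=> [|->].
  elim=> {x a} [//|x Px|x y a b _ -> _ ->|k x a _ ->|x y a b _ -> _ ->] //.
  by rewrite SP.
elim: {x} (gen x) => [|x Px|x y _ hx _ hy|k x _ hx|x y _ hx _ hy].
- by rewrite S1; constructor.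
- by rewrite SP //; constructor.
- by rewrite SD; constructor.
- by rewrite SZ; constructor.
- by rewrite SM; constructor.
Qed.
End HopfRel.
End NSym.

Section FormalMaps.
Variables (n : nat) (M : zmonType n).

Definition zvar (R : nzRingType) (i : 'I_n) : fps M R :=
  fun m => if m == zgen i then 1 else 0.

(* o(u) >= d *)
Definition ord_ge (R : nzRingType) (d : nat) (u : fps M R) : Prop :=
  forall m : M, (zdeg m < d)%N -> u m = 0.

(* u(F), for F without constant terms: then a monomial m of degree > zdeg w does
   not contribute to the coefficient of w in F^m, and the sum is all of u(F). *)
Definition subst (R : nzRingType) (F : 'I_n -> fps M R) (u : fps M R) : fps M R :=
  fun w => \sum_(m <- zmons M (zdeg w)) u m * (\prod_(i <- zword m) F i) w.

Variable K : comAlgType rat.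
Local Notation Kt := (fps tmon K).

Definition is_derivation (A : algType K) (d : endo A) : Prop :=
  forall u v : A, d (u * v) = d u * v + u * d v.

Definition der (alpha : nat) (d : endo (fps M K)) : Prop :=
  is_derivation d /\ forall i, ord_ge alpha (d (zvar K i)).

Local Notation diffop alpha := (subalg (der alpha)).

Definition diffop_op alpha (phi : diffop alpha) : endo (fps M K) := subalg_val phi.

Definition diffop_der alpha (phi : diffop alpha) : Prop := der alpha (diffop_op phi).

Lemma diffop_gen alpha (phi : diffop alpha) :
  gen_subalg (@diffop_der alpha) phi.
Proof.
case: phi => x hx; have /asboolP gx := hx.
suff H : forall y, gen_subalg (der alpha) y ->
  exists2 psi : diffop alpha, diffop_op psi = y & gen_subalg (@diffop_der alpha) psi.
  have [psi psix gpsi] := H x gx.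
  have E : psi = Subalg hx by apply: val_inj; exact: psix.
  by move: gpsi; rewrite E.
move=> y; elim=> {y} [|y dy|y z _ [p <- gp] _ [q <- gq]|k y _ [p <- gp]|y z _ [p <- gp] _ [q <- gq]].
- by exists 1 => //; constructor.
- have yin : y \in in_gen_subalg (der alpha) by apply/asboolP; constructor.
  by exists (Subalg yin) => //; apply: GenMem.
- by exists (p + q) => //; constructor.
- by exists (k *: p) => //; constructor.
- by exists (p * q) => //; constructor.
Qed.

(* The counit relation is the graph of phi |-> phi 1. *)
Lemma diffop_counit alpha (phi : diffop alpha) c :
  counit_rel (@diffop_der alpha) phi c -> diffop_op phi 1 = c%:A.
Proof.
elim=> {phi c} [|d [dd _]|p q a b _ hp _ hq|k p a _ hp|p q a b _ hp _ hq].
- by rewrite scale1r; exact: subalg_endo1.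
- rewrite scale0r; apply: (addrI (diffop_op d 1)); rewrite addr0.
  by rewrite -[in RHS](mulr1 1) dd mulr1 mul1r.
- by rewrite /diffop_op subalg_endoD scalerDl -hp -hq.
- by rewrite /diffop_op subalg_endoZ -scalerA -hp.
- rewrite /diffop_op subalg_endoM [X in subalg_val p X]hq endoZ [X in _ *: X]hp.
  by rewrite scalerA mulrC.
Qed.

(* The coefficient of t^k, as a series in z. *)
Definition tcoef (k : nat) (u : fps M Kt) : fps M K := fun w => u w k.

(* The action of sum_m t^m a_m on K[[t]]<<z>>. *)
Definition op_act (a : nat -> endo (fps M K)) (u : fps M Kt) : fps M Kt :=
  fun w => fun k : tmon => \sum_(i < k.+1) a i (tcoef (k - i) u) w.

(* F is given by the n-tuple of the F(z_i) = z_i - H_i. *)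
Definition aut_t (alpha : nat) : set ('I_n -> fps M Kt) := fun F =>
  [/\ forall i, ord_ge alpha (zvar Kt i - F i),
      forall i, tcoef 0 (zvar Kt i - F i) = 0
    & bijective (subst F)].

(* (U o V)(z) = U(V(z)) *)
Definition comp_t (U V : 'I_n -> fps M Kt) : 'I_n -> fps M Kt :=
  fun i => subst V (U i).

(* sum_m (-1)^m t^m lam_m is the operator u |-> u(F). *)
Definition is_lambda alpha (F : 'I_n -> fps M Kt) (lam : nat -> diffop alpha) : Prop :=
  lam 0%N = 1 /\
  forall u : fps M Kt,
    op_act (fun m => (-1) ^+ m *: diffop_op (lam m)) u = subst F u.

(* T = S_F *)
Definition is_S alpha (F : 'I_n -> fps M Kt)
    (T : {lrmorphism nsym K -> diffop alpha}) : Prop :=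
  exists2 lam, is_lambda F lam &
    forall m, (0 < m)%N -> T (nLambda K m) = lam m.

Definition hopf_homs alpha : set {lrmorphism nsym K -> diffop alpha} :=
  is_hopf_hom (@diffop_der alpha).
End FormalMaps.

Notation diffop M K alpha := (subalg (@der _ M K alpha)).

Inductive vars := Commutative | Noncommutative.

Definition zmon (v : vars) (n : nat) : zmonType n :=
  match v with
  | Commutative => {cmonom 'I_n}
  | Noncommutative => {fmonom 'I_n}
  end.

Definition is_group (G : Type) (X : set G) (op : G -> G -> G) : Prop :=
  [/\ forall x y, X x -> X y -> X (op x y),
      forall x y z, X x -> X y -> X z -> op x (op y z) = op (op x y) z
    & exists2 e, X e &
        (forall x, X x -> op e x = x /\ op x e = x) /\
        (forall x, X x -> exists2 y, X y & op x y = e /\ op y x = e)].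

(* Main.v *)
(* Substitution F_t acts on K<<z>>[[t]] as a power series phi(t) = lambda(-t) of
   operators with phi(0) = 1, multiplicative because substitution is a ring map;
   so is its inverse sigma(t). A series sigma with sigma(0) = 1 is multiplicative
   if and only if the coefficients psi_m of sigma^-1 sigma' are derivations. This
   puts the lambda_m in the algebra generated by derivations, and makes
   S_F(Psi_m) primitive. Conversely a Hopf map T sends the primitive Psi_m to
   derivations, so T(lambda(-t)) is a ring automorphism, and a ring map of
   K[[t]]<<z>> is the substitution of the images of the z_i. Substituting U(V) is
   phi_V phi_U, whose inverse is sigma_U sigma_V. *)

Require Import Defs.
From HB Require Import structures.
From mathcomp Require Import all_boot all_algebra finmap.
From mathcomp Require Import boolp classical_sets functions.
From mathcomp.multinomials Require Import monalg.

Set Implicit Arguments.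
Unset Strict Implicit.
Unset Printing Implicit Defensive.

Import GRing.Theory.
Local Open Scope ring_scope.

(** * Reindexing of triangular sums *)

(** Both sides run over the triples with sum [m], grouped by their last entry on the left and by
    their first entry on the right. This is the associativity of Cauchy products. *)
Lemma triangle_sum (V : nmodType) m (G : nat -> nat -> nat -> V) :
  \sum_(a < m.+1) \sum_(i < a.+1) G i (a - i)%N (m - a)%N =
  \sum_(i < m.+1) \sum_(a < (m - i).+1) G i a (m - i - a)%N.
Proof.
rewrite -(big_mkord xpredT (fun a => \sum_(i < a.+1) G i (a - i)%N (m - a)%N)).
rewrite -(big_mkord xpredT (fun i => \sum_(a < (m - i).+1) G i a (m - i - a)%N)).
transitivity (\sum_(0 <= a < m.+1) \sum_(0 <= i < m.+1 | (i <= a)%N)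
    G i (a - i)%N (m - a)%N).
  rewrite !big_nat; apply: eq_bigr => a /andP[_ am].
  rewrite -(big_mkord xpredT (fun i => G i (a - i)%N (m - a)%N)).
  by rewrite (big_nat_widen _ _ m.+1).
rewrite (exchange_big_dep xpredT) //= big_nat [RHS]big_nat.
apply: eq_bigr => i /andP[_ im].
rewrite -(big_mkord xpredT (fun a => G i a (m - i - a)%N)) -(subSn im).
have -> : \sum_(0 <= a < m.+1 | (i <= a)%N) G i (a - i)%N (m - a)%N =
          \sum_(i <= a < m.+1) G i (a - i)%N (m - a)%N.
  by rewrite [RHS](big_nat_widenl _ 0).
rewrite -{1}[i]add0n big_addn; apply: eq_bigr => a _.
by rewrite addnK addnC subnDA.
Qed.

(** * Orders and substitution of power series *)

Section Order.
Variables (n : nat) (M : zmonType n) (R : nzRingType).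
Implicit Types (u v : fps M R).

Lemma fpsDE u v m : (u + v) m = u m + v m. Proof. by []. Qed.
Lemma fpsNE u m : (- u) m = - u m. Proof. by []. Qed.
Lemma fps_sumE (I : Type) (r : seq I) (P : pred I) (F : I -> fps M R) m :
  (\sum_(i <- r | P i) F i) m = \sum_(i <- r | P i) F i m.
Proof. by elim/big_rec2: _ => // i y u _ <-. Qed.

Lemma zmon_of_cons i (s : seq 'I_n) : zmon_of M (i :: s) = mmul (zgen i) (zmon_of M s).
Proof. by rewrite /zmon_of big_cons. Qed.

Lemma zmon_of_zword (m : M) : zmon_of M (zword m) = m. Proof. exact: zwordK. Qed.

Lemma ord_ge0 u : ord_ge 0 u. Proof. by []. Qed.
Lemma ord_ge_le d e u : (d <= e)%N -> ord_ge e u -> ord_ge d u.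
Proof. by move=> de h m md; apply: h; apply: leq_trans de. Qed.
Lemma ord_geD d u v : ord_ge d u -> ord_ge d v -> ord_ge d (u + v).
Proof. by move=> hu hv m md; rewrite fpsDE hu // hv // addr0. Qed.
Lemma ord_geN d u : ord_ge d u -> ord_ge d (- u).
Proof. by move=> hu m md; rewrite fpsNE hu // oppr0. Qed.
Lemma ord_geB d u v : ord_ge d u -> ord_ge d v -> ord_ge d (u - v).
Proof. by move=> hu hv; apply: ord_geD => //; apply: ord_geN. Qed.
Lemma ord_ge_0 d : ord_ge d (0 : fps M R). Proof. by []. Qed.
Lemma ord_ge_sum d (I : Type) (r : seq I) (P : pred I) (F : I -> fps M R) :
  (forall i, P i -> ord_ge d (F i)) -> ord_ge d (\sum_(i <- r | P i) F i).
Proof. by move=> h; elim/big_ind: _ => //; exact: ord_geD. Qed.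
Lemma ord_geM d e u v : ord_ge d u -> ord_ge e v -> ord_ge (d + e) (u * v).
Proof.
move=> hu hv m md; rewrite -[LHS]/(fps_mul _ _ m) /fps_mul.
apply: big1 => a _; apply: big1 => b /eqP abm.
have [ad|da] := ltnP (zdeg a) d; first by rewrite hu // mul0r.
rewrite hv ?mulr0 // ltnNge; apply/negP => eb.
by move: md; rewrite -abm zdegM ltnNge leq_add.
Qed.
Lemma ord_ge_eq0 u : (forall d, ord_ge d u) -> u = 0.
Proof. by move=> h; apply/funext => m; apply: (h (zdeg m).+1). Qed.

Lemma ord_ge_zvar i : ord_ge 1 (@zvar n M R i).
Proof.
move=> m; rewrite /zvar; case: eqP => // ->.
by rewrite /zdeg zword_gen.
Qed.

(* Division by z_i on the left, for the monomials whose chosen word starts with i. *)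
Definition zdiv (i : 'I_n) u : fps M R := fun b =>
  let w := mmul (zgen i) b in
  if zword w is j :: s then
    if (j == i) && (zmon_of M s == b) then u w else 0
  else 0.

Lemma zvar_mulE i u w : (@zvar n M R i * u) w =
  \sum_(b <- zmons M (zdeg w) | mmul (zgen i) b == w) u b.
Proof.
rewrite -[LHS]/(fps_mul _ _ w) /fps_mul.
have [gw|wg] := boolP (zgen i \in zmons M (zdeg w)).
  rewrite (bigD1_seq (zgen i)) ?zmons_uniq //=.
  rewrite [X in _ + X]big1 ?addr0 => [|a /negPf ne]; last first.
    by apply: big1 => b _; rewrite /zvar ne mul0r.
  by apply: eq_bigr => b _; rewrite /zvar eqxx mul1r.
rewrite [RHS]big1 => [|b /eqP bw].
  rewrite big_seq big1 // => a ain; apply: big1 => b _; rewrite /zvar.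
  case: eqP => [ag|_]; last by rewrite mul0r.
  by rewrite -ag ain in wg.
by move: wg; rewrite mem_zmons -bw zdegM leq_addr.
Qed.

(** Each monomial other than 1 is produced exactly once, by the first letter of its chosen word. In
    commuting variables several z_i may divide it, which is why [zdiv] consults that word. *)
Lemma fps_decomp u :
  u = @fps_const n M R (u mone) + \sum_i @zvar n M R i * zdiv i u.
Proof.
apply/funext => w; rewrite fpsDE fps_sumE.
under eq_bigr => i _ do rewrite zvar_mulE.
have [-> | ne] := eqVneq w mone.
  rewrite /fps_const eqxx big1 ?addr0 // => i _; apply: big1 => b /eqP gb.
  by have := congr1 (@zdeg n M) gb; rewrite zdegM zdeg1 /zdeg zword_gen.
rewrite /fps_const (negPf ne) add0r.
case E: (zword w) => [|i s].
  by move: ne; rewrite -(zmon_of_zword w) E /zmon_of big_nil eqxx.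
have wE : w = mmul (zgen i) (zmon_of M s) by rewrite -zmon_of_cons -E zmon_of_zword.
have sin : zmon_of M s \in zmons M (zdeg w).
  by rewrite mem_zmons wE zdegM leq_addl.
rewrite (bigD1 i) //= [X in _ + X]big1 ?addr0 => [|j ji]; last first.
  apply: big1 => b /eqP bw; rewrite /zdiv bw E.
  by rewrite eq_sym (negPf ji).
rewrite big_mkcond (bigD1_seq (zmon_of M s)) ?zmons_uniq //= -wE eqxx.
rewrite {1}/zdiv -wE E !eqxx /= big1 ?addr0 // => b /negPf bs.
by case: eqP => // bw; rewrite /zdiv bw E eq_sym bs andbF.
Qed.

End Order.

Section Uniqueness.
Variables (n : nat) (M : zmonType n) (R : nzRingType).
Variables f g : fps M R -> fps M R.
Hypotheses (fD : {morph f : u v / u + v}) (gD : {morph g : u v / u + v}).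
Hypotheses (fM : {morph f : u v / u * v}) (gM : {morph g : u v / u * v}).
Hypothesis fc : forall c, f (@fps_const n M R c) = @fps_const n M R c.
Hypothesis gc : forall c, g (@fps_const n M R c) = @fps_const n M R c.
Hypothesis fg : forall i, f (@zvar n M R i) = g (@zvar n M R i).
Hypothesis f1 : forall i, ord_ge 1 (f (@zvar n M R i)).

(* f u - g u = sum_i f z_i (f u_i - g u_i) for u = c + sum_i z_i u_i, so the
   order of f u - g u exceeds every d. *)
Lemma fps_morph_ext : f =1 g.
Proof.
have f0 : f 0 = 0 by apply: (addrI (f 0)); rewrite -fD !addr0.
have g0 : g 0 = 0 by apply: (addrI (g 0)); rewrite -gD !addr0.
move=> u; apply/eqP; rewrite -subr_eq0; apply/eqP/ord_ge_eq0 => d.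
elim: d u => [//|d IH] u.
rewrite {1 2}(fps_decomp u) fD gD fc gc.
rewrite (big_morph f fD f0) (big_morph g gD g0).
rewrite opprD addrACA subrr add0r -sumrB; apply: ord_ge_sum => i _.
by rewrite fM gM -fg -mulrBr -add1n; apply: ord_geM.
Qed.
End Uniqueness.

(** By [triangle_sum] both sides can be grouped by the third entry of the triple, and there
    reversing the inner sum swaps the first two entries. *)
Lemma triangle_exchange (V : nmodType) m (G : nat -> nat -> nat -> V) :
  \sum_(i < m.+1) \sum_(a < (m - i).+1) G i a (m - i - a)%N =
  \sum_(a < m.+1) \sum_(i < (m - a).+1) G i a (m - a - i)%N.
Proof.
rewrite -triangle_sum -(triangle_sum m (fun a i => G i a)).
apply: eq_bigr => a _; rewrite (reindex_inj rev_ord_inj) /=.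
by apply: eq_bigr => i _; rewrite subSS subKn // -ltnS.
Qed.

(** * Products along words of monomials *)

Section WordProducts.
Variables (n : nat).

Lemma fps_mulC (M : zmonType n) (R : nzRingType) :
  (forall a b : M, mmul a b = mmul b a) -> (forall x y : R, x * y = y * x) ->
  forall u v : fps M R, u * v = v * u.
Proof.
move=> MC RC u v; apply/funext => m.
rewrite -[LHS]/(fps_mul _ _ m) -[RHS]/(fps_mul _ _ m) /fps_mul.
rewrite (exchange_big_dep xpredT) //=; apply: eq_bigr => a _.
by apply: eq_big => [b|b _]; [rewrite MC | exact: RC].
Qed.

(** The property of the chosen words on which multiplicativity of substitution rests: F^(ab) = F^a
    F^b. *)
Definition word_prodM (M : zmonType n) (R : nzRingType) : Prop :=
  forall (F : 'I_n -> fps M R) (a b : M),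
  \prod_(i <- zword (mmul a b)) F i =
  (\prod_(i <- zword a) F i) * (\prod_(i <- zword b) F i).

Lemma fmonom_word_prodM (R : nzRingType) : word_prodM {fmonom 'I_n} R.
Proof.
move=> F a b; rewrite -big_cat; congr (\prod_(i <- _) F i).
exact: fmM.
Qed.

(** The word of a product is only a rearrangement of the two words joined. Since the series commute,
    the product along a sorted word is the product of the powers F_i^(m_i), and exponents add. *)
Lemma cmonom_word_prodM (R : nzRingType) :
  (forall x y : R, x * y = y * x) -> word_prodM {cmonom 'I_n} R.
Proof.
move=> RC F a b.
have FC : forall u v : fps {cmonom 'I_n} R, u * v = v * u.
  by apply: fps_mulC => // x y; apply/eqP/cmP => i; rewrite !cmM addnC.
have wE (m : {cmonom 'I_n}) :
    \prod_(i <- zword m) F i = \prod_(i <- enum 'I_n) F i ^+ m i.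
  rewrite [zword m]/(cword m) /cword big_flatten /= big_map.
  by apply: eq_bigr => i _; rewrite big_nseq iter_mulr_1.
rewrite !wE; elim: (enum _) => [|i s IHs]; first by rewrite !big_nil mulr1.
rewrite !big_cons IHs cmM exprD -!mulrA; congr (_ * _).
by rewrite !mulrA; congr (_ * _); exact: FC.
Qed.

End WordProducts.

Section Subst.
Variables (n : nat) (M : zmonType n) (R : nzRingType).
Variable F : 'I_n -> fps M R.
Hypothesis F1 : forall i, ord_ge 1 (F i).
Implicit Types (u v : fps M R).

Lemma ord_ge_prod (s : seq 'I_n) : ord_ge (size s) (\prod_(i <- s) F i).
Proof.
elim: s => [|i s IHs]; first exact: ord_ge0.
by rewrite big_cons /= -add1n; apply: ord_geM.
Qed.

(** The extra monomials have degree above that of [w], so the corresponding products of the F_i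
    vanish at [w]. Different coefficients can thus be summed over one common range. *)
Lemma subst_bound d u w : (zdeg w <= d)%N ->
  subst F u w = \sum_(m <- zmons M d) u m * (\prod_(i <- zword m) F i) w.
Proof.
move=> wd; transitivity (\sum_(m <- zmons M (zdeg w) | (zdeg m <= zdeg w)%N)
    u m * (\prod_(i <- zword m) F i) w).
  rewrite /subst big_seq [RHS]big_seq_cond; apply: eq_bigl => m.
  by rewrite mem_zmons andbb.
rewrite (zmons_sub _ wd) // [RHS](bigID (fun m => (zdeg m <= zdeg w)%N)) /=.
rewrite [X in _ = _ + X]big1 ?addr0 // => m; rewrite -ltnNge => wm.
by rewrite ord_ge_prod ?mulr0.
Qed.

Lemma substD : {morph subst F : u v / u + v}.
Proof.
move=> u v; apply/funext => w; rewrite fpsDE /subst -big_split /=.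
by apply: eq_bigr => m _; rewrite fpsDE mulrDl.
Qed.

Lemma substB u v : subst F (u - v) = subst F u - subst F v.
Proof. by apply/eqP; rewrite eq_sym subr_eq -substD subrK. Qed.

Lemma subst_ord d u : ord_ge d u -> ord_ge d (subst F u).
Proof.
move=> hu w wd; rewrite /subst big_seq big1 // => m; rewrite mem_zmons => mw.
by rewrite hu ?mul0r //; apply: leq_ltn_trans wd.
Qed.

Lemma subst_const c : subst F (@fps_const n M R c) = @fps_const n M R c.
Proof.
apply/funext => w; rewrite /subst.
rewrite (bigD1_seq mone) ?zmons_uniq //= ?mem_zmons ?zdeg1 //.
rewrite [X in _ + X]big1 => [|m /negPf ne]; last by rewrite /fps_const ne mul0r.
have -> : zword (@mone M) = [::] by apply: size0nil; exact: zdeg1.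
rewrite big_nil addr0 {1}/fps_const eqxx -[1]/(@fps_const n M R 1) /fps_const.
by case: ifP; rewrite ?mulr1 ?mulr0.
Qed.

Lemma subst_zvar i : subst F (@zvar n M R i) = F i.
Proof.
(* The bound is raised by one so that z_i, of degree 1, is in range even when [w] is the empty
   monomial. *)
apply/funext => w; rewrite (@subst_bound (zdeg w).+1) //.
rewrite (bigD1_seq (zgen i)) ?zmons_uniq //=; last by rewrite mem_zmons /zdeg zword_gen.
rewrite [X in _ + X]big1 => [|m /negPf ne]; last by rewrite /zvar ne mul0r.
by rewrite addr0 /zvar eqxx mul1r zword_gen big_seq1.
Qed.

Hypothesis RC : forall x y : R, x * y = y * x.
Hypothesis wordM : word_prodM M R.

(** Both sides reduce to the sum over pairs a, b of u_a v_b times the coefficient of [w] in F^a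
    F^b. *)
Lemma substM : {morph subst F : u v / u * v}.
Proof.
move=> u v; apply/funext => w; set d := zdeg w; set Z := zmons M d.
pose P (m : M) := \prod_(i <- zword m) F i.
transitivity (\sum_(a <- Z) \sum_(b <- Z) u a * v b * (P a * P b) w).
  transitivity (\sum_(m <- Z) \sum_(a <- Z) \sum_(b <- Z | mmul a b == m)
      u a * v b * P m w).
    rewrite /subst big_seq [RHS]big_seq; apply: eq_bigr => m; rewrite mem_zmons => md.
    rewrite -[(u * v) m]/(fps_mul u v m) (fps_mulw u v md) mulr_suml.
    by apply: eq_bigr => a _; rewrite mulr_suml.
  rewrite exchange_big /=; apply: eq_bigr => a _.
  under eq_bigr => m _ do rewrite big_mkcond /=.
  rewrite exchange_big /=; apply: eq_bigr => b _; rewrite -big_mkcond /=.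
  rewrite -wordM -/(P (mmul a b)).
  (* A pair whose product has degree above [d] occurs in no coefficient of u v that is used, and
     F^(ab) vanishes at [w] by its order. *)
  have [abZ|abZ] := boolP (mmul a b \in Z).
    rewrite (big_only _ (zmons_uniq M d) abZ) // => m /=; exact: eq_sym.
  rewrite big_seq_cond big1 => [|m /andP[mZ /eqP abm]]; last by rewrite abm mZ in abZ.
  by rewrite /P ord_ge_prod ?mulr0 // ltnNge; move: abZ; rewrite mem_zmons.
symmetry; rewrite -[LHS]/(fps_mul _ _ w) /fps_mul -/d -/Z.
transitivity (\sum_(x <- Z) \sum_(y <- Z | mmul x y == w)
   \sum_(a <- Z) \sum_(b <- Z) u a * v b * (P a x * P b y)).
  rewrite big_seq [RHS]big_seq; apply: eq_bigr => x; rewrite mem_zmons => xd.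
  rewrite big_seq_cond [RHS]big_seq_cond; apply: eq_bigr => y /andP[].
  rewrite mem_zmons => yd _; rewrite (subst_bound _ xd) (subst_bound _ yd) mulr_suml.
  apply: eq_bigr => a _; rewrite mulr_sumr; apply: eq_bigr => b _.
  by rewrite -!mulrA; congr (_ * _); rewrite !mulrA; congr (_ * _); exact: RC.
under eq_bigr => x _ do rewrite exchange_big /=.
rewrite exchange_big /=; apply: eq_bigr => a _.
under eq_bigr => x _ do rewrite exchange_big /=.
rewrite exchange_big /=; apply: eq_bigr => b _.
rewrite -[(P a * P b) w]/(fps_mul _ _ w) /fps_mul mulr_sumr.
by apply: eq_bigr => x _; rewrite mulr_sumr.
Qed.

End Subst.

(** * Power series of operators *)

Section EndoSeq.
Variables (K : comNzRingType) (A : algType K).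
Implicit Types (a b : nat -> endo A).

Lemma endo_sumE (I : Type) (r : seq I) (P : pred I) (f : I -> endo A) u :
  (\sum_(i <- r | P i) f i) u = \sum_(i <- r | P i) f i u.
Proof. by elim/big_rec2: _ => // i y g _ <-. Qed.

Definition cauchy_prod (B : pzRingType) (a b : nat -> B) (m : nat) : B :=
  \sum_(i < m.+1) a i * b (m - i)%N.

(* The sequence a of operators is a sequence of divided powers, that is,
   sum_m t^m a_m is multiplicative. *)
Definition leibniz a : Prop :=
  forall m u v, a m (u * v) = \sum_(i < m.+1) a i u * a (m - i)%N v.

(** In the expansion of a_(m+1)(1 * 1) the inner terms vanish by induction and both outer terms
    equal x = a_(m+1)(1), so x = x + x. *)
Lemma leibniz_one a m : a 0%N = 1 -> leibniz a -> a m.+1 1 = 0.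
Proof.
move=> a0 La; elim/ltn_ind: m => m IH.
have := La m.+1 1 1; rewrite mulr1 big_ord_recl big_ord_recr /= a0 subnn a0.
rewrite [X in _ + (X + _)]big1 => [|i _]; last first.
  by rewrite IH ?mul0r.
rewrite subn0 /= -[bump 0 m]/m.+1 mul1r mulr1 add0r.
by move/eqP; rewrite eq_sym -subr_eq0 addrK => /eqP.
Qed.

End EndoSeq.

Section OpAct.
Variables (n : nat) (M : zmonType n) (K : comAlgType rat).
Local Notation B := (fps M K).
Local Notation Kt := (fps tmon K).
Implicit Types (a b : nat -> endo B) (U V : fps M Kt) (u v : B).

Lemma tcoefP U V : (forall k, tcoef k U = tcoef k V) -> U = V.
Proof.
move=> UV; apply/funext => w; apply/funext => k.
exact: (congr1 (fun u : B => u w) (UV k)).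
Qed.

Lemma tcoefD k U V : tcoef k (U + V) = tcoef k U + tcoef k V.
Proof. by []. Qed.

(** This identifies the ring K[[t]]<<z>> with the power series in t over K<<z>>. *)
Lemma tcoefM k U V :
  tcoef k (U * V) = \sum_(i < k.+1) tcoef i U * tcoef (k - i) V.
Proof.
apply/funext => w; rewrite fps_sumE.
transitivity (\sum_(i < k.+1) fps_mul (tcoef i U) (tcoef (k - i) V) w) => //.
rewrite -[LHS]/(fps_mul U V w k) /fps_mul fps_sumE.
rewrite [RHS]exchange_big /=; apply: eq_bigr => x _.
rewrite fps_sumE [RHS]exchange_big /=; apply: eq_bigr => y _.
exact: fps_tmonE.
Qed.

Lemma tcoef_const k (c : Kt) : tcoef k (@fps_const n M Kt c) = c k *: (1 : B).
Proof.
apply/funext => w; rewrite /tcoef /fps_const -[RHS]/(c k * (1 : B) w).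
rewrite -[(1 : B) w]/(if w == mone then 1 else 0).
by case: ifP; rewrite ?mulr1 ?mulr0.
Qed.

Definition tconst u : fps M Kt := fun w => fun k : tmon => if k == 0%N then u w else 0.

Lemma tcoef_tconst k u : tcoef k (tconst u) = if k == 0%N then u else 0.
Proof. by apply/funext => w; rewrite /tcoef /tconst; case: (k == 0)%N. Qed.

Lemma tconstM u v : tconst (u * v) = tconst u * tconst v.
Proof.
apply: tcoefP => k; rewrite tcoefM tcoef_tconst.
rewrite big_ord_recl big1 ?addr0 => [|i _]; last by rewrite tcoef_tconst mul0r.
by rewrite /= subn0 !tcoef_tconst /=; case: (k == 0)%N; rewrite ?mulr0.
Qed.

Lemma tcoef_zvar k i :
  tcoef k (@zvar n M Kt i) = if k == 0%N then @zvar n M K i else 0.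
Proof.
by apply/funext => w; rewrite /tcoef /zvar; case: k => [|k] /=; case: (w == _).
Qed.

Lemma zvar_tconst i : @zvar n M Kt i = tconst (@zvar n M K i).
Proof. by apply: tcoefP => k; rewrite tcoef_zvar tcoef_tconst. Qed.

Lemma ord_ge_tcoef d U : ord_ge d U <-> forall k, ord_ge d (tcoef k U).
Proof.
split=> [h k w wd|h w wd]; first by rewrite /tcoef h.
by apply/funext => k; exact: h.
Qed.

Lemma tcoef_op_act a U k :
  tcoef k (op_act a U) = \sum_(i < k.+1) a i (tcoef (k - i) U).
Proof. by apply/funext => w; rewrite fps_sumE. Qed.

(** On series constant in t the action shows the single operators, so it determines the sequence
    [a]. *)
Lemma tcoef_op_act_tconst a u k : tcoef k (op_act a (tconst u)) = a k u.
Proof.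
rewrite tcoef_op_act big_ord_recr /= subnn tcoef_tconst big1 ?add0r // => i _.
by rewrite tcoef_tconst subn_eq0 leqNgt ltn_ord /= linear0.
Qed.

Lemma op_act_inj a b : op_act a = op_act b -> a = b.
Proof.
move=> ab; apply/funext => k; apply: endoP => u.
by rewrite -!tcoef_op_act_tconst ab.
Qed.

Lemma op_actD a : {morph op_act a : U V / U + V}.
Proof.
move=> U V; apply: tcoefP => k; rewrite tcoefD !tcoef_op_act -big_split /=.
by apply: eq_bigr => i _; rewrite tcoefD linearD.
Qed.

Lemma op_act_comp a b U : op_act (cauchy_prod a b) U = op_act a (op_act b U).
Proof.
apply: tcoefP => k; rewrite !tcoef_op_act.
under eq_bigr => m _ do rewrite endo_sumE.
rewrite (triangle_sum k (fun i j l => (a i * b j) (tcoef l U))).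
apply: eq_bigr => i _; rewrite tcoef_op_act linear_sum.
by apply: eq_bigr => j _.
Qed.

Lemma op_act1 U : op_act (fun m => if m is 0 then 1 else 0) U = U.
Proof.
apply: tcoefP => k; rewrite tcoef_op_act big_ord_recl /= subn0.
by rewrite big1 ?addr0.
Qed.

(** Since a_0 = 1, the coefficient of t^k in the image is that of the argument plus terms in its
    lower coefficients; these agree by induction. *)
Lemma op_act_cancel_inj a : a 0%N = 1 -> injective (op_act a).
Proof.
move=> a0 U V UV; apply: tcoefP; apply: ltn_ind => k IH.
have := congr1 (tcoef k) UV; rewrite !tcoef_op_act !big_ord_recl /= a0 !subn0.
rewrite [X in _ + X](_ : _ = \sum_(i < k) a (lift ord0 i) (tcoef (k - lift ord0 i) V)).
  by move/addIr.
by apply: eq_bigr => i _; rewrite IH // /= /bump /= add1n ltn_subrL /= (leq_trans _ (ltn_ord i)).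
Qed.

(** One direction tests on series constant in t. For the other, both coefficients of t^k are the sum
    of a_p(U_j) a_q(V_l) over p + q + j + l = k. *)
Lemma op_act_leibniz a : {morph op_act a : U V / U * V} <-> leibniz a.
Proof.
split=> [aM m u v|La U V].
  rewrite -tcoef_op_act_tconst tconstM aM tcoefM.
  by apply: eq_bigr => i _; rewrite !tcoef_op_act_tconst.
apply: tcoefP => k; rewrite tcoef_op_act tcoefM.
transitivity (\sum_(i < k.+1) \sum_(p < i.+1)
    \sum_(j < (k - i).+1) a p (tcoef j U) * a (i - p)%N (tcoef (k - i - j) V)).
  apply: eq_bigr => i _; rewrite tcoefM linear_sum /=.
  by rewrite exchange_big /=; apply: eq_bigr => j _; rewrite La.
rewrite (triangle_sum k (fun p q l => \sum_(j < l.+1)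
    a p (tcoef j U) * a q (tcoef (l - j) V))).
symmetry; transitivity (\sum_(m < k.+1) \sum_(p < m.+1)
    a p (tcoef (m - p) U) * tcoef (k - m) (op_act a V)).
  by apply: eq_bigr => m _; rewrite tcoef_op_act mulr_suml.
rewrite (triangle_sum k (fun p r l => a p (tcoef r U) * tcoef l (op_act a V))).
apply: eq_bigr => p _.
rewrite (triangle_exchange _ (fun q j l => a p (tcoef j U) * a q (tcoef l V))).
by apply: eq_bigr => r _; rewrite tcoef_op_act mulr_sumr.
Qed.

Lemma op_act_const a c : a 0%N = 1 -> leibniz a ->
  op_act a (@fps_const n M Kt c) = @fps_const n M Kt c.
Proof.
move=> a0 La; apply: tcoefP => k; rewrite tcoef_op_act big_ord_recl /= subn0.
rewrite big1 => [|i _]; last by rewrite tcoef_const linearZ /= leibniz_one ?scaler0.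
by rewrite addr0 a0.
Qed.

Lemma Kt_mulC (x y : Kt) : x * y = y * x.
Proof. by apply: fps_mulC => [i j|]; [exact: addnC | exact: mulrC]. Qed.

Section SubstOp.
Variable F : 'I_n -> fps M Kt.

Fact subst_coef_linear m : linear (fun u : B => (fun w : M =>
  \sum_(x <- zmons M (zdeg w)) u x * (\prod_(i <- zword x) F i) w m) : B).
Proof.
move=> k u v; apply/funext => w; rewrite -[RHS]/(k * _ + _) mulr_sumr -big_split /=.
by apply: eq_bigr => x _; rewrite mulrA -mulrDl.
Qed.

(* The coefficient of t^m in u |-> u(F). *)
Definition subst_coef (m : nat) : endo B :=
  HB.pack (fun u : B => (fun w : M =>
    \sum_(x <- zmons M (zdeg w)) u x * (\prod_(i <- zword x) F i) w m) : B)
  (GRing.isLinear.Build K B B _ _ (subst_coef_linear m)).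

Lemma op_act_subst : op_act subst_coef = subst F.
Proof.
apply/funext => U; apply: tcoefP => k; rewrite tcoef_op_act; apply/funext => w.
rewrite fps_sumE /tcoef /subst fps_sumE exchange_big /=.
apply: eq_bigr => x _; rewrite Kt_mulC fps_tmonE.
by apply: eq_bigr => i _; rewrite mulrC.
Qed.
End SubstOp.

Lemma subst_coef_zvar (F : 'I_n -> fps M Kt) m i : (forall i, ord_ge 1 (F i)) ->
  subst_coef F m (@zvar n M K i) = tcoef m (F i).
Proof. by move=> F1; rewrite -tcoef_op_act_tconst -zvar_tconst op_act_subst subst_zvar. Qed.

Lemma subst_coef_tconst (F : 'I_n -> fps M Kt) m u :
  subst_coef F m u = tcoef m (subst F (tconst u)).
Proof. by rewrite -op_act_subst tcoef_op_act_tconst. Qed.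

Hypothesis wordM : word_prodM M Kt.

Lemma leibniz_subst_coef (F : 'I_n -> fps M Kt) :
  (forall i, ord_ge 1 (F i)) -> leibniz (subst_coef F).
Proof.
move=> F1; apply/op_act_leibniz; rewrite op_act_subst.
exact: substM F1 Kt_mulC wordM.
Qed.

(** F is the identity modulo t, so the coefficient of t^0 of its substitution is a ring map fixing
    constants and every z_i. By [fps_morph_ext] it is the identity. *)
Lemma subst_coef0 (F : 'I_n -> fps M Kt) :
  (forall i, ord_ge 1 (F i)) -> (forall i, tcoef 0 (F i) = @zvar n M K i) ->
  subst_coef F 0 = 1.
Proof.
move=> F1 F0; apply: endoP => u; rewrite subst_coef_tconst.
pose f0 u := tcoef 0 (subst F (tconst u)).
have f0D : {morph f0 : x y / x + y}.
  by move=> x y; rewrite /f0 -!subst_coef_tconst linearD.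
apply: (@fps_morph_ext _ _ _ f0 id) => //.
- move=> x y; rewrite /f0 -!subst_coef_tconst (leibniz_subst_coef F1).
  by rewrite big_ord1.
- move=> c; have -> : @fps_const n M K c = c *: 1.
    by apply/funext => w; rewrite -[RHS]/(c * _) /fps_const;
       rewrite -[(1 : B) w]/(if w == mone then 1 else 0); case: ifP; rewrite ?mulr1 ?mulr0.
  rewrite /f0 -subst_coef_tconst linearZZ subst_coef_tconst; congr (_ *: _).
  have -> : tconst 1 = @fps_const n M Kt 1.
    apply: tcoefP => -[|k]; rewrite tcoef_tconst tcoef_const.
      by rewrite -[(1 : Kt) 0%N]/(1 : K) scale1r.
    by rewrite -[(1 : Kt) k.+1]/(0 : K) scale0r.
  by rewrite subst_const tcoef_const -[(1 : Kt) 0%N]/(1 : K) scale1r.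
- by move=> i; rewrite /f0 -zvar_tconst subst_zvar //; exact: F0.
- by move=> i; rewrite /f0 -zvar_tconst subst_zvar // F0; exact: ord_ge_zvar.
Qed.

End OpAct.

(** * The generators Psi and derivations *)

Section NatScale.
Variables (K : comAlgType rat) (V : lmodType K).

Definition invn (m : nat) : K := in_alg K m%:R^-1.

Lemma invnK m : m.+1%:R * invn m.+1 = 1.
Proof.
rewrite /invn -(rmorph_nat (in_alg K)) -rmorphM mulfV ?rmorph1 //.
by rewrite Num.Theory.pnatr_eq0.
Qed.

Lemma scale_invn m (x : V) : invn m.+1 *: (x *+ m.+1) = x.
Proof. by rewrite -scaler_nat scalerA mulrC invnK scale1r. Qed.

Lemma mulrSn_inj m (x y : V) : x *+ m.+1 = y *+ m.+1 -> x = y.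
Proof. by move=> xy; rewrite -(scale_invn m x) xy scale_invn. Qed.
End NatScale.

Section PsiLeibniz.
Variables (K : comAlgType rat) (A : algType K) (s p : nat -> endo A).
Hypotheses (s0 : s 0%N = 1) (p0 : p 0%N = 0).
(* The relation sigma'(t) = sigma(t) psi(t). *)
Hypothesis sp : forall m u, s m u *+ m = \sum_(i < m.+1) s (m - i)%N (p i u).

(** The coefficient of t^m in sigma(t)u * sigma(t)v. *)
Let C m (u v : A) := \sum_(a < m.+1) s a u * s (m - a)%N v.

(** This is the product rule for t d/dt: the factor m splits as a + (m - a), and [sp] is applied to
    each factor. *)
Let C_psi m u v : C m u v *+ m =
  \sum_(i < m.+1) (C (m - i) (p i u) v + C (m - i) u (p i v)).
Proof.
rewrite big_split /=.
have -> : C m u v *+ m = \sum_(a < m.+1) (s a u *+ a) * s (m - a)%N v +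
    \sum_(a < m.+1) s a u * (s (m - a)%N v *+ (m - a)).
  rewrite -big_split -sumrMnl; apply: eq_bigr => a _ /=.
  by rewrite mulrnAl mulrnAr -mulrnDr subnKC // -ltnS.
congr (_ + _).
  under [LHS]eq_bigr => a _ do rewrite sp mulr_suml.
  exact: (triangle_sum m (fun i j l => s j (p i u) * s l v)).
under [LHS]eq_bigr => a _ do rewrite sp mulr_sumr.
exact: (triangle_exchange m (fun a i l => s a u * s l (p i v))).
Qed.

(** The two sides of the Leibniz identity satisfy the same recursion. As p_0 = 0, it involves only
    smaller indices, and the factor m + 1 can be divided out over the rationals. *)
Lemma leibniz_of_derivations : (forall m, is_derivation (p m)) -> leibniz s.
Proof.
move=> dp m u v; elim/ltn_ind: m u v => -[_|m IH] u v.
  by rewrite big_ord1 s0.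
apply: (@mulrSn_inj _ _ m); rewrite sp C_psi [LHS]big_ord_recl [RHS]big_ord_recl !p0.
have zl k x : C k (0 : A) x = 0.
  by rewrite /C big1 // => a _; rewrite linear0 mul0r.
have zr k x : C k x (0 : A) = 0.
  by rewrite /C big1 // => a _; rewrite linear0 mulr0.
rewrite zl zr linear0 !add0r; apply: eq_bigr => i _.
rewrite dp linearD /= !IH //; by rewrite /bump /= add1n subSS ltnS leq_subr.
Qed.

(** Comparing both recursions for m s_m(uv), the defects of p_i from the Leibniz rule satisfy sum_i
    s_(m-i)(defect_i) = 0. Those with i < m vanish by induction, and s_0 = 1 isolates the last. *)
Lemma derivations_of_leibniz : leibniz s -> forall m, is_derivation (p m).
Proof.
move=> Ls m u v; apply/eqP; rewrite -subr_eq0; apply/eqP.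
elim/ltn_ind: m => m IH; have := C_psi m u v; rewrite /C -Ls sp.
under [RHS]eq_bigr => i _ do rewrite -!Ls -linearD.
move/eqP; rewrite -subr_eq0 -sumrB big_ord_recr big1 /= ?add0r => [|i _].
  by rewrite subnn s0 => /eqP.
by rewrite -linearB /= IH ?linear0.
Qed.
End PsiLeibniz.

(** * Generators of NSym and the operators they act by *)

Section NSymGen.
Variable K : comAlgType rat.

Lemma in_gen_subalgP (A : algType K) (X : A -> Prop) x :
  reflect (gen_subalg X x) (x \in in_gen_subalg X).
Proof. exact: asboolP. Qed.

Lemma nsym_gen_Lambda (x : nsym K) :
  gen_subalg (fun y => exists m, y = nLambda K m.+1) x.
Proof.
apply/in_gen_subalgP; rewrite [x]monalgE; apply: rpred_sum => w _.
have -> : << x@_w *g w >> = x@_w *: (<< w >> : nsym K).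
  by apply/malgP => w'; rewrite mcoeffZ !mcoeffU mulr_natr.
apply: rpredZ; rewrite -[w]fmK; elim: (w : seq nat) => [|i s IHs].
  by rewrite -fmoneE; exact: rpred1.
have -> : << FMonom (i :: s) >> = (<< fmu i >> * << FMonom s >> : nsym K).
  rewrite malgM_def fgmulUU mul1r; congr (<< _ >>).
  by apply/eqP; rewrite fmP; apply/eqP; rewrite fmM fmU.
by apply: rpredM => //; apply/in_gen_subalgP/GenMem; exists i.
Qed.

(** The relation t sigma' = sigma * (t psi). The dummy value of [nPsi] at index 0 is 1, hence the
    explicit zero there. *)
Lemma nS_psi m : (m%:R : nsym K) * nS K m =
  \sum_(i < m.+1) nS K (m - i) * (if (i : nat) is 0 then 0 else nPsi K i).
Proof.
case: m => [|m]; first by rewrite mul0r big_ord1 mulr0.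
rewrite nPsi_gen [RHS]big_ord_recl mulr0 add0r; apply: eq_bigr => i _ /=.
by rewrite /bump /= add1n subSS.
Qed.

(** The recursion for m S_m, divided by m, puts the S_m in the subalgebra; then sigma(t) lambda(-t)
    = 1, solved for its last term, does so for the Lambda_m. *)
Lemma nsym_gen_Psi (x : nsym K) :
  gen_subalg (fun y => exists m, y = nPsi K m.+1) x.
Proof.
set X := (fun y : nsym K => _).
have SX m : nS K m \in in_gen_subalg X.
  elim/ltn_ind: m => -[_|m IH]; first exact: rpred1.
  rewrite -(scale_invn m (nS K m.+1)) -mulr_natl nPsi_gen.
  apply: rpredZ; apply: rpred_sum => i _; apply: rpredM.
    by apply: IH; rewrite ltnS leq_subr.
  by apply/in_gen_subalgP/GenMem; exists i.
have LX m : nLambda K m \in in_gen_subalg X.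
  elim/ltn_ind: m => -[_|m IH]; first exact: rpred1.
  have := congr1 (fun f => f m.+1) (nS_gen K); rewrite fps_tmonE big_ord_recl subn0.
  rewrite -[RHS]/(0 : nsym K) mul1r => /eqP; rewrite addr_eq0 => /eqP E.
  rewrite -[nLambda K m.+1](signrMK m.+1) E; apply: rpredM.
    by rewrite rpredX // rpredN rpred1.
  rewrite rpredN; apply: rpred_sum => i _; apply: rpredM => //.
  apply: rpredM; first by rewrite rpredX // rpredN rpred1.
  by apply: IH; rewrite /= /bump /= add1n subSS ltnS leq_subr.
apply/in_gen_subalgP; elim: {x} (nsym_gen_Lambda x) => [|x [m ->]|x y _ + _|k x _|x y _ + _].
- exact: rpred1.
- exact: LX.
- exact: rpredD.
- exact: rpredZ.
- exact: rpredM.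
Qed.
End NSymGen.

Lemma endo_scaleE (K : comNzRingType) (A : algType K) (f : endo A) k u :
  (k *: f) u = k *: f u.
Proof. by []. Qed.

Lemma endo_mulrnE (K : comNzRingType) (A : algType K) (f : endo A) m u :
  (f *+ m) u = f u *+ m.
Proof. by elim: m => [|m IHm] //; rewrite !mulrS -IHm. Qed.

Section NSymAction.
Variables (K : comAlgType rat) (A : algType K).
Variable T : {lrmorphism nsym K -> endo A}.

Let p i : endo A := if i is 0 then 0 else T (nPsi K i).

Let p_sp m u : T (nS K m) u *+ m = \sum_(i < m.+1) T (nS K (m - i)%N) (p i u).
Proof.
transitivity (T ((m%:R : nsym K) * nS K m) u).
  by rewrite mulr_natl raddfMn endo_mulrnE.
rewrite nS_psi rmorph_sum endo_sumE; apply: eq_bigr => i _; rewrite rmorphM.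
by rewrite /p; case: (i : nat) => [|j]; rewrite ?rmorph0.
Qed.

(** T carries [nS_psi] to sigma' = sigma psi among operators, so the criterion for logarithmic
    derivatives applies in both directions. *)
Lemma leibniz_nS : leibniz (fun m => T (nS K m)) <->
  forall m, is_derivation (T (nPsi K m.+1)).
Proof.
have s0 : T (nS K 0) = 1 by exact: rmorph1.
split=> [Ls m|dT]; first exact: (derivations_of_leibniz s0 p_sp Ls m.+1).
apply: (leibniz_of_derivations s0 (erefl : p 0 = 0) p_sp) => -[|m]; last exact: dT.
by move=> u v; rewrite /p /= mul0r mulr0 addr0.
Qed.
End NSymAction.

Section NSymOpAct.
Variables (n : nat) (M : zmonType n) (K : comAlgType rat).
Local Notation B := (fps M K).
Variable T : {lrmorphism nsym K -> endo B}.

Lemma op_act_nS_Lambda U :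
  op_act (fun m => T (nS K m)) (op_act (fun m => (-1) ^+ m *: T (nLambda K m)) U) = U.
Proof.
rewrite -op_act_comp -[RHS]op_act1; congr (op_act _ U); apply/funext => m.
transitivity (T (((nS K : fps tmon (nsym K)) *
    (fun j : tmon => (-1) ^+ (j : nat) * nLambda K j)) m)).
  rewrite fps_tmonE rmorph_sum; apply: eq_bigr => i _.
  rewrite rmorphM rmorphM rmorph_sign; congr (_ * _).
  by rewrite -signr_odd -[in RHS]signr_odd; case: odd; rewrite ?scaleN1r ?mulN1r ?scale1r ?mul1r.
by rewrite nS_gen; case: m => [|m]; [exact: rmorph1|exact: rmorph0].
Qed.

(** The action of sigma(t) starts with 1 and is therefore injective; a right inverse of an injective
    map is also a left inverse. *)
Lemma op_act_Lambda_nS U :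
  op_act (fun m => (-1) ^+ m *: T (nLambda K m)) (op_act (fun m => T (nS K m)) U) = U.
Proof.
apply: (@op_act_cancel_inj _ _ _ (fun m => T (nS K m))); first exact: rmorph1.
by rewrite op_act_nS_Lambda.
Qed.

(** The actions of sigma(t) and lambda(-t) are mutually inverse, and the inverse of a multiplicative
    bijection is multiplicative. *)
Lemma leibniz_nS_Lambda : leibniz (fun m => T (nS K m)) <->
  leibniz (fun m => (-1) ^+ m *: T (nLambda K m)).
Proof.
split=> /op_act_leibniz H; apply/op_act_leibniz => U V.
  by rewrite -{1}(op_act_nS_Lambda U) -{1}(op_act_nS_Lambda V) -H op_act_Lambda_nS.
by rewrite -{1}(op_act_Lambda_nS U) -{1}(op_act_Lambda_nS V) -H op_act_nS_Lambda.
Qed.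
End NSymOpAct.

(** * Operators compatible with the order filtration *)

Section Filtered.
Variables (n : nat) (M : zmonType n) (K : comAlgType rat) (alpha : nat).
Local Notation B := (fps M K).
Local Notation z := (@zvar n M K).

Lemma ord_geZ d (c : K) (u : B) : ord_ge d u -> ord_ge d (c *: u).
Proof. by move=> hu m md; rewrite -[LHS]/(c * u m) hu // mulr0. Qed.

Lemma fps_constE (c : K) : @fps_const n M K c = c *: (1 : B).
Proof.
apply/funext => m; rewrite -[RHS]/(c * @fps_const n M K 1 m) /fps_const.
by case: ifP; rewrite ?mulr1 ?mulr0.
Qed.

Lemma derivation1 (A : algType K) (d : endo A) : is_derivation d -> d 1 = 0.
Proof.
move=> dd; apply: (addrI (d 1)); rewrite addr0.
by rewrite -[in RHS](mulr1 1) dd mulr1 mul1r.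
Qed.

(* d u = sum_i d(z_i) u_i + z_i d(u_i) for u = c + sum_i z_i u_i. *)
Lemma der_ord (d : endo B) u : der alpha d -> ord_ge alpha (d u).
Proof.
case=> dd dz; suff H k : (k <= alpha)%N -> forall v, ord_ge k (d v) by exact: H.
elim: k => [_ v|k IH ka v]; first exact: ord_ge0.
rewrite (fps_decomp v) linearD fps_constE linearZ /= derivation1 // scaler0 add0r.
rewrite linear_sum; apply: ord_ge_sum => i _; rewrite dd; apply: ord_geD.
  by rewrite -[k.+1]addn0; apply: ord_geM => //; apply: ord_ge_le (dz i).
rewrite -add1n; apply: ord_geM; first exact: ord_ge_zvar.
by apply: IH; exact: ltnW.
Qed.

(** A necessary condition for membership in D^[alpha] that is stable under the algebra operations;
    the clause on series of order alpha is what makes it pass to products. For operators killing 1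
    the scalar is 0, which leaves the order condition of [der]. *)
Definition filtered (e : endo B) : Prop := exists c : K,
  [/\ e 1 = c%:A, forall i, ord_ge alpha (e (z i) - c *: z i)
    & forall u, ord_ge alpha u -> ord_ge alpha (e u)].

Lemma filtered_gen (X : endo B -> Prop) e :
  (forall x, X x -> filtered x) -> gen_subalg X e -> filtered e.
Proof.
move=> hX; elim=> {e} [|x /hX//|x y _ [c [x1 xz xa]] _ [d [y1 yz ya]]|
    k x _ [c [x1 xz xa]]|x y _ [c [x1 xz xa]] _ [d [y1 yz ya]]].
- by exists 1; split=> [|i|//]; rewrite ?scale1r // subrr.
- exists (c + d); split=> [|i|u hu].
  + by rewrite -[LHS]/(x 1 + y 1) x1 y1 scalerDl.
  + rewrite -[(x + y) (z i)]/(x (z i) + y (z i)) scalerDl opprD addrACA.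
    exact: ord_geD.
  + by apply: ord_geD; [exact: xa | exact: ya].
- exists (k * c); split=> [|i|u hu].
  + by rewrite endo_scaleE x1 scalerA.
  + rewrite endo_scaleE -scalerA -scalerBr.
    exact: ord_geZ.
  + by apply: ord_geZ; exact: xa.
- exists (c * d); split=> [|i|u hu].
  + by rewrite -[LHS]/(x (y 1)) y1 linearZ /= x1 scalerA mulrC.
  + have -> : (x * y) (z i) - (c * d) *: z i =
        x (y (z i) - d *: z i) + d *: (x (z i) - c *: z i).
      by rewrite linearB [x (d *: _)]endoZ scalerBr addrA subrK scalerA [d * c]mulrC.
    by apply: ord_geD; [exact: xa | exact: ord_geZ].
  + by apply: xa; exact: ya.
Qed.

Lemma der_filtered d : der alpha d -> filtered d.
Proof.
move=> dd; exists 0; split=> [|i|u _]; last exact: der_ord.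
  by rewrite scale0r; apply: derivation1; case: dd.
by rewrite scale0r subr0; exact: der_ord.
Qed.

Lemma filtered_ord e i : filtered e -> e 1 = 0 -> ord_ge alpha (e (z i)).
Proof.
case=> c [e1 ez _] e10.
have c0 : c = 0.
  have := congr1 (fun u : B => u mone) e1; rewrite e10 -fps_constE /fps_const eqxx.
  by move=> <-.
by have := ez i; rewrite c0 scale0r subr0.
Qed.

(** This recovers the order bound for a derivation that is only known to be an element of
    D^[alpha]. *)
Lemma derivation_filtered d : is_derivation d -> filtered d -> der alpha d.
Proof.
move=> dd fd; split=> // i; apply: filtered_ord => //; exact: derivation1.
Qed.
End Filtered.

(** * Coproducts and the action on products *)

Section CoprodAction.
Variables (K : comAlgType rat) (A : algType K) (X : endo A -> Prop).
Local Notation D := (subalg X).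
Local Notation op := (@subalg_val K (endo A) X).
Variable P : D -> Prop.
Hypothesis derP : forall d, P d -> is_derivation (op d).

Let act2 u v (p q : D) : A := op p u * op q v.
Let act2l u v q : linear ((act2 u v)^~ q).
Proof. by move=> k p p'; rewrite /act2 subalg_endoD subalg_endoZ mulrDl scalerAl. Qed.
Let act2r u v p : linear (act2 u v p).
Proof. by move=> k q q'; rewrite /act2 subalg_endoD subalg_endoZ mulrDr scalerAr. Qed.

Let act2E u v s : tens_lift (act2 u v) (tens_cls s) = \sum_(p <- s) act2 u v p.1 p.2.
Proof. exact: tens_liftE (act2l u v) (act2r u v) s. Qed.

(** A product of tensors is evaluated by letting the right factor act first, on each component. *)
Let act2_mul u v s t : \sum_(p <- tens_mulseq s t) act2 u v p.1 p.2 =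
  \sum_(q <- t) \sum_(p <- s) act2 (op q.1 u) (op q.2 v) p.1 p.2.
Proof. by rewrite /tens_mulseq big_allpairs_dep exchange_big. Qed.

(* The coproduct of an operator describes its action on products. *)
Lemma coprod_rel_act (d : D) a : coprod_rel P d a ->
  forall u v, op d (u * v) = tens_lift (fun p q : D => op p u * op q v) a.
Proof.
elim=> {d a} [|d dd|d e a b _ hd _ he|k d a _ hd|d e a b _ hd _ he] u v.
- by rewrite -[X in tens_lift _ X]/(tens_cls [:: (1 : D, 1 : D)]) act2E big_seq1.
- rewrite [tens 1 d + tens d 1]tens_addE act2E big_cons big_seq1.
  by rewrite addrC; apply: derP.
- rewrite subalg_endoD hd he.
  rewrite -[a]tens_repK -[b]tens_repK [tens_cls _ + _]tens_addE !act2E.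
  by rewrite big_cat.
- rewrite subalg_endoZ hd -[a]tens_repK [_ *: tens_cls _]tens_scaleE !act2E big_map.
  rewrite scaler_sumr; apply: eq_bigr => p _.
  by rewrite /act2 subalg_endoZ scalerAl.
- rewrite subalg_endoM he -[a]tens_repK -[b]tens_repK [_ * tens_cls _]tens_mulE !act2E.
  rewrite act2_mul linear_sum; apply: eq_bigr => q _.
  by rewrite [LHS]hd -{1}[a]tens_repK act2E.
Qed.

(** Every tensor related to [d] computes d(uv), so a primitive one gives the Leibniz rule even where
    [coprod_rel] is not single valued. *)
Lemma coprod_rel_derivation (d : D) :
  coprod_rel P d (tens 1 d + tens d 1) -> is_derivation (op d).
Proof.
move=> /coprod_rel_act H u v; rewrite H [tens 1 d + tens d 1]tens_addE.
by rewrite act2E big_cons big_seq1 addrC.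
Qed.
End CoprodAction.

Section HopfHom.
Variables (n : nat) (M : zmonType n) (K : comAlgType rat) (alpha : nat).
Local Notation B := (fps M K).
Local Notation D := (diffop M K alpha).

Lemma diffop_filtered (d : D) : filtered alpha (diffop_op d).
Proof.
case: d => e /= /asboolP; apply: filtered_gen => x; exact: der_filtered.
Qed.

Fact diffop_op_is_lr : [/\ zmod_morphism (@diffop_op n M K alpha),
   monoid_morphism (@diffop_op n M K alpha) & scalable (@diffop_op n M K alpha)].
Proof. by []. Qed.

Definition diffop_val : {lrmorphism D -> endo B} :=
  HB.pack (@diffop_op n M K alpha)
    (GRing.isZmodMorphism.Build _ _ _ (let: And3 h _ _ := diffop_op_is_lr in h))
    (GRing.isMonoidMorphism.Build _ _ _ (let: And3 _ h _ := diffop_op_is_lr in h))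
    (GRing.isScalable.Build _ _ _ _ _ (let: And3 _ _ h := diffop_op_is_lr in h)).

Lemma diffop_op_inj : injective (@diffop_op n M K alpha).
Proof. exact: val_inj. Qed.

End HopfHom.

(** * Hopf maps *)

Section TensMap.
Variables (K : comNzRingType) (A B : algType K) (T : {lrmorphism A -> B}).
Local Notation TT := (tens_map T T).

Let Tl : linear T. Proof. exact: linearP. Qed.

Lemma tens_map_tens a b : TT (tens a b) = tens (T a) (T b).
Proof. exact: (tens_mapE Tl Tl). Qed.

Lemma tens_mapD x y : TT (x + y) = TT x + TT y.
Proof.
rewrite -[x]tens_repK -[y]tens_repK [tens_cls _ + _]tens_addE !(tens_mapE Tl Tl).
by rewrite [RHS]tens_addE /tens_mapseq map_cat.
Qed.

Lemma tens_mapZ k x : TT (k *: x) = k *: TT x.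
Proof.
rewrite -[x]tens_repK [_ *: tens_cls _]tens_scaleE !(tens_mapE Tl Tl).
rewrite [RHS]tens_scaleE /tens_mapseq -!map_comp; congr tens_cls.
by apply: eq_map => -[a b] /=; rewrite linearZZ.
Qed.

Lemma tens_mapM x y : TT (x * y) = TT x * TT y.
Proof.
rewrite -[x]tens_repK -[y]tens_repK [tens_cls _ * _]tens_mulE !(tens_mapE Tl Tl).
rewrite [RHS]tens_mulE; congr tens_cls; rewrite /tens_mulseq /tens_mapseq.
rewrite map_allpairs allpairs_mapl allpairs_mapr.
by congr flatten; apply: eq_map => p; apply: eq_map => q; rewrite /= !rmorphM.
Qed.

Lemma tens_map1 : TT 1 = 1.
Proof. by rewrite [LHS]tens_map_tens rmorph1. Qed.
End TensMap.

Section Antipode.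
Variable K : comAlgType rat.
Local Notation nsymC := (GRing.converse (nsym K)).

Lemma conv_constM (A : algType K) k (x : A) :
  conv_const A k * (x : GRing.converse A) = k *: x.
Proof. by transitivity (x * k%:A) => //; rewrite mulr_algr. Qed.

Lemma nsym_antipode1 : nsym_antipode (1 : nsym K) = 1.
Proof. exact: (@nsym_lift1 K nsymC (conv_const (nsym K))). Qed.

Lemma nsym_antipodeD (x y : nsym K) :
  nsym_antipode (x + y) = nsym_antipode x + nsym_antipode y.
Proof. exact: (@nsym_liftD K nsymC (conv_const (nsym K))). Qed.

Lemma nsym_antipodeZ k (x : nsym K) :
  nsym_antipode (k *: x) = k *: nsym_antipode x.
Proof.
rewrite -[RHS]conv_constM; exact: (@nsym_liftZ K nsymC (conv_const (nsym K))).
Qed.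

Lemma nsym_coprodD (x y : nsym K) : nsym_coprod (x + y) = nsym_coprod x + nsym_coprod y.
Proof. by rewrite -[in LHS](scale1r x) nsym_coprod_linear scale1r. Qed.

Lemma nsym_coprodZ k (x : nsym K) : nsym_coprod (k *: x) = k *: nsym_coprod x.
Proof.
have D0 : @nsym_coprod K 0 = 0 by exact: nsym_lift0.
by rewrite -[k *: x]addr0 nsym_coprod_linear D0 addr0.
Qed.
End Antipode.

Section NSymMorphism.
Variables (K : comAlgType rat) (A : algType K) (T : {lrmorphism nsym K -> A}).
Implicit Types x y : nsym K.

Lemma nsym_morphD x y : T (x + y) = T x + T y. Proof. exact: rmorphD. Qed.
Lemma nsym_morphZ k x : T (k *: x) = k *: T x. Proof. exact: linearZZ. Qed.
Lemma nsym_morphM x y : T (x * y) = T x * T y. Proof. exact: rmorphM. Qed.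
Lemma nsym_morph1 : T (1 : nsym K) = 1. Proof. exact: rmorph1. Qed.
End NSymMorphism.

Section PsiHopf.
Variables (K : comAlgType rat) (A : algType K) (P : A -> Prop).
Variable T : {lrmorphism nsym K -> A}.

Lemma hopf_hom_coprod_Psi m : is_hopf_hom P T ->
  coprod_rel P (T (nPsi K m.+1)) (tens 1 (T (nPsi K m.+1)) + tens (T (nPsi K m.+1)) 1).
Proof.
case=> /(_ (nPsi K m.+1)) + _ _.
by rewrite nsym_coprod_Psi tens_mapD !tens_map_tens rmorph1.
Qed.

(** The Psi_m generate NSym, and each of the three relations has a clause for generators and for
    every algebra operation. An expression of x in the Psi_m is thus carried over term by term. *)
Lemma hopf_hom_of_Psi : (forall m, P (T (nPsi K m.+1))) -> is_hopf_hom P T.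
Proof.
move=> PT; split=> x; elim: {x} (nsym_gen_Psi x) => [|x [m ->]|x y _ hx _ hy|k x _ hx|x y _ hx _ hy].
- rewrite nsym_coprod1 tens_map1 rmorph1; exact: CoprodOne.
- rewrite nsym_coprod_Psi tens_mapD !tens_map_tens rmorph1.
  by apply: CoprodGen; exact: PT.
- rewrite nsym_coprodD tens_mapD nsym_morphD; exact: CoprodAdd hx hy.
- rewrite nsym_coprodZ tens_mapZ nsym_morphZ; exact: CoprodScale hx.
- rewrite nsym_coprodM tens_mapM nsym_morphM; exact: CoprodMul hx hy.
- rewrite rmorph1 [nsym_counit _]nsym_lift1; exact: CounitOne.
- by rewrite nsym_counit_Psi; apply: CounitGen; exact: PT.
- rewrite nsym_morphD [nsym_counit _]nsym_liftD; exact: CounitAdd hx hy.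
- rewrite nsym_morphZ [nsym_counit _]nsym_liftZ; exact: CounitScale hx.
- rewrite nsym_morphM nsym_counitM; exact: CounitMul hx hy.
- rewrite nsym_antipode1 rmorph1; exact: AntipodeOne.
- by rewrite nsym_antipode_Psi rmorphN; apply: AntipodeGen; exact: PT.
- move: (nsym_antipode (x + y)) (nsym_antipodeD x y) => w E.
  rewrite nsym_morphD E nsym_morphD; exact: AntipodeAdd hx hy.
- move: (nsym_antipode (k *: x)) (nsym_antipodeZ k x) => w E.
  rewrite nsym_morphZ E nsym_morphZ; exact: AntipodeScale hx.
- move: (nsym_antipode (x * y)) (nsym_antipodeM x y) => w E.
  rewrite nsym_morphM E nsym_morphM; exact: AntipodeMul hx hy.
Qed.
End PsiHopf.

Section LRMorph.
Variables (K : comAlgType rat) (A : algType K).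

Lemma nsym_lrmorph_ext (T T' : {lrmorphism nsym K -> A}) :
  (forall m, T (nLambda K m.+1) = T' (nLambda K m.+1)) -> T = T'.
Proof.
move=> TT'; apply: lrmorph_ext; suff H (x : nsym K) : T x = T' x by exact: H.
elim: {x} (nsym_gen_Lambda x) => [|x [m ->]|x y _ hx _ hy|k x _ hx|x y _ hx _ hy].
- by rewrite !nsym_morph1.
- exact: TT'.
- by rewrite nsym_morphD nsym_morphD hx hy.
- by rewrite nsym_morphZ nsym_morphZ hx.
- by rewrite nsym_morphM nsym_morphM hx hy.
Qed.

Lemma nsym_hom_Lambda (l : nat -> A) m : l 0%N = 1 -> nsym_hom l (nLambda K m) = l m.
Proof. by move=> l0; apply: nsym_lift_Lambda. Qed.
End LRMorph.

(** * The group isomorphism *)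

(** It gives the Hopf maps their group laws, closure under [conv] included, along the bijection with
    the formal maps. *)
Lemma is_group_transport (G H : Type) (X : set G) (Y : set H)
    (op : G -> G -> G) (op' : H -> H -> H) (f : G -> H) :
  set_bij X Y f -> (forall x y, X x -> X y -> f (op x y) = op' (f x) (f y)) ->
  is_group X op -> is_group Y op'.
Proof.
move=> [fXY _ fsurj] fM [opX opA [e Xe [e1 inv]]].
split=> [x y|x y z|].
- move=> /fsurj[a Xa <-] /fsurj[b Xb <-]; rewrite -fM //; apply: fXY; exact: opX.
- move=> /fsurj[a Xa <-] /fsurj[b Xb <-] /fsurj[c Xc <-].
  by rewrite -(fM b) // -(fM a b) // -!fM ?opA //; apply: opX.
- exists (f e); first exact: fXY.
  split=> [x /fsurj[a Xa <-]|x /fsurj[a Xa <-]].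
    by rewrite -!fM // !(e1 _ Xa).1 !(e1 _ Xa).2.
  have [b Xb [ab ba]] := inv _ Xa.
  by exists (f b); [exact: fXY | rewrite -!fM // ab ba].
Qed.

(** * Formal maps and their substitutions *)

Section FormalMapGroup.
Variables (n : nat) (M : zmonType n) (K : comAlgType rat) (alpha : nat).
Local Notation B := (fps M K).
Local Notation Kt := (fps tmon K).
Local Notation zt := (@zvar n M Kt).
Local Notation z := (@zvar n M K).
Local Notation AA := (@aut_t n M K alpha).
Hypothesis alpha_gt0 : (0 < alpha)%N.
Hypothesis wordM : word_prodM M Kt.

Lemma tcoefB k (U V : fps M Kt) : tcoef k (U - V) = tcoef k U - tcoef k V.
Proof. by []. Qed.

Lemma ord_ge1_sub_zvar (u : fps M Kt) i : ord_ge alpha (zt i - u) -> ord_ge 1 u.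
Proof.
move=> hu; rewrite -[u](subKr (zt i)).
by apply: ord_geB; [exact: ord_ge_zvar | exact: ord_ge_le hu].
Qed.

Lemma aut_t_ord1 F : AA F -> forall i, ord_ge 1 (F i).
Proof. by case=> hF _ _ i; exact: ord_ge1_sub_zvar (hF i). Qed.

Lemma aut_t_tcoef0 F : AA F -> forall i, tcoef 0 (F i) = z i.
Proof.
by case=> _ F0 _ i; have /eqP := F0 i; rewrite tcoefB tcoef_zvar subr_eq0 => /eqP.
Qed.

Lemma aut_t_tcoefS F m : AA F -> forall i, ord_ge alpha (tcoef m.+1 (F i)).
Proof.
case=> hF _ _ i; have /ord_ge_tcoef/(_ m.+1) := hF i.
by rewrite tcoefB tcoef_zvar sub0r => /ord_geN; rewrite opprK.
Qed.

Lemma subst_ext (F : 'I_n -> fps M Kt) (g : fps M Kt -> fps M Kt) :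
  (forall i, ord_ge 1 (F i)) -> {morph g : u v / u + v} -> {morph g : u v / u * v} ->
  (forall c, g (@fps_const n M Kt c) = @fps_const n M Kt c) ->
  (forall i, g (zt i) = F i) -> subst F = g.
Proof.
move=> F1 gD gM gc gz; apply/funext; apply: fps_morph_ext => //.
- exact: substD.
- exact: (substM F1 (@Kt_mulC K) wordM).
- by move=> c; exact: subst_const.
- by move=> i; rewrite subst_zvar.
- by move=> i; rewrite subst_zvar.
Qed.

(** Both sides are ring maps over K[[t]] that agree on the z_i. Substitution reverses the order of
    composition. *)
Lemma subst_comp (U V : 'I_n -> fps M Kt) :
  (forall i, ord_ge 1 (U i)) -> (forall i, ord_ge 1 (V i)) ->
  subst (comp_t U V) = subst V \o subst U.
Proof.
move=> U1 V1; apply: subst_ext => [i|u v|u v|c|i] /=.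
- exact: subst_ord.
- by rewrite !substD.
- by rewrite !(substM _ (@Kt_mulC K) wordM).
- by rewrite !subst_const.
- by rewrite subst_zvar.
Qed.

Lemma subst_id : subst zt = id.
Proof. by apply: subst_ext => // i; exact: ord_ge_zvar. Qed.

Lemma aut_t_id : AA zt.
Proof.
split=> [i|i|]; rewrite ?subrr; [exact: ord_ge_0 | by [] |].
by rewrite subst_id; exists id.
Qed.

Lemma aut_t_comp U V : AA U -> AA V -> AA (comp_t U V).
Proof.
move=> AU AV; have U1 := aut_t_ord1 AU; have V1 := aut_t_ord1 AV.
have V0 := subst_coef0 wordM V1 (aut_t_tcoef0 AV).
have [hU U0 bU] := AU; have [hV W0 bV] := AV.
(* With H_F = z - F this reads H_(U o V) = H_V + H_U(V), so order and vanishing at t = 0 are checked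
   on each summand. *)
have E i : zt i - comp_t U V i = (zt i - V i) + subst V (zt i - U i).
  by rewrite substB subst_zvar // addrA subrK.
split=> [i|i|].
- by rewrite E; apply: ord_geD => //; exact: subst_ord.
- by rewrite E tcoefD W0 add0r -op_act_subst tcoef_op_act big_ord1 V0 U0.
- by rewrite subst_comp //; exact: bij_comp.
Qed.

(** The map is read off from the images of the z_i, and [subst_ext] recognises the action as its
    substitution. For k > 0 the operator a_k kills 1, so filteredness bounds the order of
    a_k(z_i). *)
Lemma op_act_aut (a : nat -> endo B) :
  a 0%N = 1 -> leibniz a -> (forall m, filtered alpha (a m)) -> bijective (op_act a) ->
  AA (fun i => op_act a (zt i)) /\ subst (fun i => op_act a (zt i)) = op_act a.
Proof.
move=> a0 La fa ba; set F := fun i => op_act a (zt i).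
have tF k i : tcoef k (zt i - F i) = (if k == 0%N then z i else 0) - a k (z i).
  by rewrite tcoefB tcoef_zvar /F zvar_tconst tcoef_op_act_tconst.
have hF i : ord_ge alpha (zt i - F i).
  apply/ord_ge_tcoef => -[|k]; rewrite tF /=; first by rewrite a0 subrr.
  by rewrite sub0r; apply: ord_geN; apply: filtered_ord => //; exact: leibniz_one.
have F1 i : ord_ge 1 (F i) by exact: ord_ge1_sub_zvar (hF i).
have E : subst F = op_act a.
  apply: subst_ext => //; [exact: op_actD | exact/op_act_leibniz |].
  by move=> c; exact: op_act_const.
by split=> //; split=> // [i|]; rewrite ?E // tF /= a0 subrr.
Qed.
End FormalMapGroup.

Lemma gen_subalg_nsym (K : comAlgType rat) (A : algType K) (T : {lrmorphism nsym K -> A})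
    (X : nsym K -> Prop) (Y : A -> Prop) x :
  (forall y, X y -> Y (T y)) -> gen_subalg X x -> gen_subalg Y (T x).
Proof.
move=> XY; elim=> {x} [|x /XY|x y _ hx _ hy|k x _ hx|x y _ hx _ hy].
- rewrite nsym_morph1; exact: GenOne.
- exact: GenMem.
- rewrite nsym_morphD; exact: GenAdd hx hy.
- rewrite nsym_morphZ; exact: GenScale hx.
- rewrite nsym_morphM; exact: GenMul hx hy.
Qed.

(** * The correspondence between formal maps and Hopf maps *)

Section SubstitutionHopf.
Variables (n : nat) (M : zmonType n) (K : comAlgType rat) (alpha : nat).
Local Notation B := (fps M K).
Local Notation Kt := (fps tmon K).
Local Notation zt := (@zvar n M Kt).
Local Notation z := (@zvar n M K).
Local Notation AA := (@aut_t n M K alpha).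
Local Notation D := (diffop M K alpha).
Local Notation HH := (@hopf_homs n M K alpha).
Hypothesis alpha_gt0 : (0 < alpha)%N.
Hypothesis wordM : word_prodM M Kt.
Implicit Types (F U V : 'I_n -> fps M Kt) (T : {lrmorphism nsym K -> D}).

(** This is T followed by the inclusion of D^[alpha] into all endomorphisms, see [nsym_opE]. *)
Definition nsym_op T : {lrmorphism nsym K -> endo B} :=
  nsym_hom (fun m => diffop_op (T (nLambda K m))).

Lemma nsym_opE T x : nsym_op T x = diffop_op (T x).
Proof.
pose T' : {lrmorphism nsym K -> endo B} :=
  [the {lrmorphism nsym K -> endo B} of @diffop_val n M K alpha \o T].
suff -> : nsym_op T = T' by [].
apply: nsym_lrmorph_ext => m; rewrite nsym_hom_Lambda //.
by rewrite nsym_morph1.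
Qed.

Lemma is_SE F T : is_S F T <->
  op_act (fun m => (-1) ^+ m *: nsym_op T (nLambda K m)) = subst F.
Proof.
split=> [[lam [lam0 lamE] TL]|E].
  apply/funext => u; rewrite -lamE; congr (op_act _ u); apply/funext => m.
  rewrite nsym_opE; congr (_ *: diffop_op _).
  by case: m => [|m]; [rewrite nsym_morph1 lam0 | rewrite TL].
exists (fun m => T (nLambda K m)) => //; split; first exact: nsym_morph1.
move=> u; rewrite -E; congr (op_act _ u); apply/funext => m.
by rewrite nsym_opE.
Qed.

Lemma is_S_inj F T T' : is_S F T -> is_S F T' -> T = T'.
Proof.
move=> /is_SE ET /is_SE ET'; apply: nsym_lrmorph_ext => m; apply: diffop_op_inj.
have /(congr1 (fun f => f m.+1)) := op_act_inj (etrans ET (esym ET')).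
by move/(congr1 ( *:%R ((-1) ^+ m.+1))); rewrite !signrZK !nsym_opE.
Qed.

(** A Hopf map sends Psi_m to an element with primitive coproduct, hence to a derivation, and
    membership in D^[alpha] supplies the order bound. *)
Lemma hopf_homs_Psi T : HH T <-> forall m, der alpha (nsym_op T (nPsi K m.+1)).
Proof.
split=> [hT m|dT].
  rewrite nsym_opE; apply: derivation_filtered; last exact: diffop_filtered.
  apply: coprod_rel_derivation (hopf_hom_coprod_Psi m hT).
  by move=> d [].
apply: hopf_hom_of_Psi => m; move: (dT m); rewrite nsym_opE; exact.
Qed.

Lemma hopf_homs_leibniz T : HH T -> leibniz (fun m => nsym_op T (nS K m)).
Proof. by move=> /hopf_homs_Psi dT; apply/leibniz_nS => m; case: (dT m). Qed.

(** The point is that the coefficients of the substitution lie in D^[alpha]. The algebra map is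
    first built into all endomorphisms; its values on the Psi_m turn out to be derivations of the
    right order, and these generate its image. *)
Lemma is_S_exists F : AA F -> exists2 T, is_S F T & HH T.
Proof.
move=> AF; have F1 := aut_t_ord1 alpha_gt0 AF.
pose phi := subst_coef F.
have phi0 : phi 0%N = 1 := subst_coef0 wordM F1 (aut_t_tcoef0 AF).
have Lphi : leibniz phi by exact: leibniz_subst_coef.
pose T0 := nsym_hom (fun m => (-1) ^+ m *: phi m).
have T0L m : (-1) ^+ m *: T0 (nLambda K m) = phi m.
  by rewrite nsym_hom_Lambda ?signrZK // phi0 scale1r.
have fphi m : filtered alpha (phi m.+1).
  (* The scalar is 0 because phi_(m+1) kills 1. *)
  exists 0; split=> [|i|u hu].
  - by rewrite scale0r; exact: leibniz_one.
  - by rewrite scale0r subr0 /phi subst_coef_zvar //; exact: aut_t_tcoefS.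
  (* Here u is read as a series constant in t; substitution keeps its order, and so does each
     coefficient of t. *)
  - rewrite /phi subst_coef_tconst; move: m.+1; apply/ord_ge_tcoef/subst_ord => //.
    by apply/ord_ge_tcoef => -[|k]; rewrite tcoef_tconst.
have fT0 x : filtered alpha (T0 x).
  apply: (@filtered_gen _ _ _ _ (fun e => exists m, e = phi m.+1)).
    by move=> e [m ->]; exact: fphi.
  elim: {x} (nsym_gen_Lambda x) => [|x [m ->]|x y _ hx _ hy|k x _ hx|x y _ hx _ hy].
  - rewrite nsym_morph1; exact: GenOne.
  - rewrite nsym_hom_Lambda; last by rewrite phi0 scale1r.
    by apply: GenScale; apply: GenMem; exists m.
  - rewrite nsym_morphD; exact: GenAdd hx hy.
  - rewrite nsym_morphZ; exact: GenScale hx.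
  - rewrite nsym_morphM; exact: GenMul hx hy.
have dPsi m : der alpha (T0 (nPsi K m.+1)).
  apply: derivation_filtered => //; move: m; apply/leibniz_nS/leibniz_nS_Lambda.
  by rewrite (_ : (fun m => _) = phi) //; apply/funext.
have T0D x : T0 x \in in_gen_subalg (der alpha).
  apply/in_gen_subalgP; apply: gen_subalg_nsym (nsym_gen_Psi x) => y [m ->].
  exact: dPsi.
pose T := nsym_hom (fun m => Subalg (T0D (nLambda K m))) : {lrmorphism nsym K -> D}.
have lam0 : Subalg (T0D (nLambda K 0)) = 1.
  by apply: diffop_op_inj; exact: nsym_morph1.
have TE : nsym_op T = T0.
  by apply: nsym_lrmorph_ext => m; rewrite nsym_opE nsym_hom_Lambda.
exists T.
  by apply/is_SE; rewrite TE -op_act_subst; congr op_act; apply/funext.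
by apply/(hopf_homs_Psi T) => m; rewrite TE; exact: dPsi.
Qed.

(** The required map sends z_i to T(lambda(-t)) z_i; the action of T(sigma(t)) is the inverse of its
    substitution. *)
Lemma hopf_homs_surj T : HH T -> exists2 F, AA F & is_S F T.
Proof.
move=> hT; pose a m := (-1) ^+ m *: nsym_op T (nLambda K m).
have a0 : a 0%N = 1 by rewrite /a nsym_morph1 scale1r.
have La : leibniz a by apply/leibniz_nS_Lambda; exact: hopf_homs_leibniz.
have fa m : filtered alpha (a m).
  rewrite /a nsym_opE; have [c [d1 dz da]] := diffop_filtered (T (nLambda K m)).
  exists ((-1) ^+ m * c); split=> [|i|u hu]; rewrite endo_scaleE.
  - by rewrite d1 scalerA.
  - by rewrite -scalerA -scalerBr; apply: ord_geZ.
  - by apply: ord_geZ; exact: da.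
have ba : bijective (op_act a).
  exists (op_act (fun m => nsym_op T (nS K m))) => u.
    exact: op_act_nS_Lambda.
  exact: op_act_Lambda_nS.
have [AF E] := op_act_aut alpha_gt0 wordM a0 La fa ba.
by eexists; first exact: AF; apply/is_SE; rewrite E.
Qed.

(** The inverse sends z_i to S_F(sigma(t)) z_i. Being multiplicative and filtered, the action of
    sigma(t) is again a substitution of the required kind. *)
Lemma aut_t_inv F : AA F -> exists2 G, AA G & comp_t F G = zt /\ comp_t G F = zt.
Proof.
move=> AF; have [T /is_SE TF hT] := is_S_exists AF.
pose a m := nsym_op T (nS K m).
have a0 : a 0%N = 1 by exact: nsym_morph1.
have fa m : filtered alpha (a m) by rewrite /a nsym_opE; exact: diffop_filtered.
have aF w : op_act a (subst F w) = w by rewrite -TF; exact: op_act_nS_Lambda.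
have Fa w : subst F (op_act a w) = w by rewrite -TF; exact: op_act_Lambda_nS.
have ba : bijective (op_act a) by exists (subst F).
have [AG E] := op_act_aut alpha_gt0 wordM a0 (hopf_homs_leibniz hT) fa ba.
have F1 := aut_t_ord1 alpha_gt0 AF.
eexists; first exact: AG.
split; apply/funext => i; last by rewrite /comp_t Fa.
by rewrite /comp_t E -[F i](subst_zvar F1) aF.
Qed.

Lemma aut_t_group : is_group AA (@comp_t n M K).
Proof.
split=> [U V|U V W AU AV AW|]; first exact: aut_t_comp.
  apply/funext => i; rewrite /comp_t.
  by rewrite -/(comp_t V W) subst_comp //; exact: (aut_t_ord1 alpha_gt0).
exists zt; first exact: aut_t_id.
split=> F AF; last exact: aut_t_inv.
split; apply/funext => i; rewrite /comp_t ?subst_id //.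
by rewrite subst_zvar //; exact: aut_t_ord1 AF.
Qed.

Lemma is_S_comp U V T T' : AA U -> AA V -> is_S U T -> is_S V T' ->
  is_S (comp_t U V) (conv T T').
Proof.
move=> AU AV /is_SE TU /is_SE TV; apply/is_SE.
rewrite subst_comp //; [|exact: aut_t_ord1 AU|exact: aut_t_ord1 AV].
apply/funext => u /=.
pose S T m := nsym_op T (nS K m).
have S0 T1 : S T1 0%N = 1 by exact: nsym_morph1.
have SE : S (conv T T') = cauchy_prod (S T) (S T').
  apply/funext => m; rewrite /S nsym_opE conv_S /cauchy_prod.
  rewrite [LHS](raddf_sum (@diffop_val n M K alpha)); apply: eq_bigr => i _.
  by rewrite !nsym_opE.
(* Both sides become u once the injective action of the product sigma_U sigma_V is applied to
   them. *)
apply: (op_act_cancel_inj (S0 (conv T T'))).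
rewrite [LHS]op_act_nS_Lambda SE op_act_comp.
by rewrite -TV [op_act (S T') _]op_act_nS_Lambda -TU [RHS]op_act_nS_Lambda.
Qed.

Lemma substitution_hopf_iso :
  [/\ is_group AA (@comp_t n M K),
      is_group HH (@conv K D)
    & exists SS : ('I_n -> fps M Kt) -> {lrmorphism nsym K -> D},
        [/\ forall F, AA F -> forall T, is_S F T <-> T = SS F,
            set_bij AA HH SS
          & forall U V, AA U -> AA V -> SS (comp_t U V) = conv (SS U) (SS V)]].
Proof.
have [F|SS SSP] := @choice _ _ (fun F T => AA F -> is_S F T).
  (* [SS] is a total function, so tuples outside the group receive an arbitrary algebra map. *)
  have [AF|nAF] := pselect (AA F); last by exists (nsym_hom (fun=> 0)) => /nAF.
  by have [T TF _] := is_S_exists AF; exists T.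
have SSE F : AA F -> forall T, is_S F T <-> T = SS F.
  move=> AF T; split=> [TF|->]; last exact: SSP.
  exact: is_S_inj TF (SSP F AF).
have SSM U V : AA U -> AA V -> SS (comp_t U V) = conv (SS U) (SS V).
  move=> AU AV; apply/esym/SSE; first exact: aut_t_comp.
  by apply: is_S_comp => //; exact: SSP.
have bij : set_bij AA HH SS.
  split=> [F AF|U V|T hT].
  - by have [T /(SSE F AF)-> ] := is_S_exists AF.
  (* S_F determines the substitution of F, whose value at z_i is F_i. *)
  - rewrite !inE => AU AV UV; apply/funext => i.
    have /is_SE EU := SSP U AU; have /is_SE EV := SSP V AV.
    rewrite -(subst_zvar (aut_t_ord1 alpha_gt0 AU)).
    by rewrite -(subst_zvar (aut_t_ord1 alpha_gt0 AV)) -EU -EV UV.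
  - have [F AF FT] := hopf_homs_surj hT; exists F => //.
    by apply/esym/(SSE F AF).
split; [exact: aut_t_group | | by exists SS].
exact: is_group_transport bij SSM aut_t_group.
Qed.
End SubstitutionHopf.

Theorem theorem4p3 (K : comAlgType rat) (v : vars) (n : nat) (hn : (0 < n)%N)
    (alpha : nat) (halpha : (0 < alpha)%N) :
  let A := @aut_t n (zmon v n) K alpha in
  let D : algType K := diffop (zmon v n) K alpha in
  let Hopf := @hopf_homs n (zmon v n) K alpha in
  [/\ is_group A (@comp_t n (zmon v n) K),
      is_group Hopf (@conv K D)
    & exists SS : ('I_n -> fps (zmon v n) (fps tmon K)) -> {lrmorphism nsym K -> D},
        [/\ forall F, A F -> forall T, is_S F T <-> T = SS F,
            set_bij A Hopf SS
          & forall U V, A U -> A V -> SS (comp_t U V) = conv (SS U) (SS V)]].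
Proof.
(* The two kinds of variables are told apart only in the proof of [word_prodM]. *)
apply: substitution_hopf_iso => //; case: v.
  exact: (cmonom_word_prodM (@Kt_mulC K)).
exact: fmonom_word_prodM.
Qed.
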